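(* Let $I\subseteq\mathsf{k}[x,y]$ be a non-principal monomial ideal, let $P$ be a set with $P(I)\subseteq P\subseteq P^{\ast}(I)$, let $D\ge D_P:=(\mu(I)-|P|)\cdot\delta_P+|P|\cdot d_P$ be an integer, and let $s\ge D+r(P,D)+1$ be an integer. Then for all integers $\ell\ge0$, $$\mu(I^{s+\ell})=\mu(I^s)+\ell\left(\mu(I^{s+1})-\mu(I^s)\right).$$
   Context: $\mathsf{k}$ is a field, $\mathbb{N}=\{1,2,\dots\}$. For a nonzero monomial ideal $I\subseteq\mathsf{k}[x,y]$: $\mathsf{G}(I)$ is its minimal set of monomial generators, $\mu(I)=|\mathsf{G}(I)|$, and $\gcd(I)$ is the greatest common divisor of all monomials in $I$. For $\bullet\in\{x,y\}$, $\operatorname{dist}_\bullet(I):=\max\{\deg_\bullet g\mid g\in\mathsf{G}(I:\gcd(I))\}$; for monomials $g,h$, $\operatorname{dist}_\bullet(g,h)$ is $\operatorname{dist}_\bullet$ of the ideal $(g,h)$. The integral closure $\overline{I}$ is the monomial ideal whose monomials are those $f$ with $f^n\in I^n$ for some $n\in\mathbb{N}$. A generator $f\in\mathsf{G}(I)$ is persistent if $f\notin\overline{(g,h)}$ for all monomials $g,h\in I\setminus\{f\}$; $P(I)$ is the set of persistent generators. $f\in\mathsf{G}(I)$ is weakly persistent if $f^n\in\mathsf{G}(I^n)$ for all $n\in\mathbb{N}$; $P^{\ast}(I)$ is the set of weakly persistent generators. Write $P=\{g_1,\dots,g_{k+1}\}$ in descending $y$-degree. Then $\delta_P:=\max_{1\le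 i\le k}\min\{\operatorname{dist}_x(g_i,g_{i+1}),\operatorname{dist}_y(g_i,g_{i+1})\}-1$; $d_P:=\min\{\operatorname{dist}_x(I),\operatorname{dist}_y(I)\}-2$ if $|P|>2$ and $d_P:=0$ if $|P|=2$; for $\bullet\in\{x,y\}$, $r_\bullet(P,D):=\left\lceil D\cdot\max_{1\le i\le k}\frac{\operatorname{dist}_\bullet(I)}{\operatorname{dist}_\bullet(g_i,g_{i+1})}\right\rceil$; and $r(P,D):=\min\{r_x(P,D),r_y(P,D)\}$. *)

(* Defs.v *)
From HB Require Import structures.
From mathcomp Require Import all_boot all_order all_algebra finmap.
From mathcomp.multinomials Require Export mpoly.
From Stdlib Require Import ClassicalEpsilon.

Set Implicit Arguments.
Unset Strict Implicit.
Unset Printing Implicit Defensive.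

Import Order.TTheory GRing.Theory Num.Theory.

Local Open Scope ring_scope.

(* Ideals are predicates compared extensionally. The ideals of ring_quotient   *)
(* cannot be used: they are boolean and always proper.                         *)

Section Ideals.
Variable R : comNzRingType.

Definition same_ideal (I J : R -> Prop) : Prop := forall p, I p <-> J p.

Definition ideal_gen (A : R -> Prop) (p : R) : Prop :=
  exists s : seq (R * R),
    (forall u, u \in s -> A u.2) /\ p = \sum_(u <- s) u.1 * u.2.

Definition principal (I : R -> Prop) : Prop :=
  exists f, same_ideal I (ideal_gen (fun p => p = f)).

Definition ideal_mul (I J : R -> Prop) : R -> Prop :=
  ideal_gen (fun p => exists a b, [/\ I a, J b & p = a * b]).

Definition ideal_pow (I : R -> Prop) (n : nat) : R -> Prop :=
  iter n (ideal_mul I) (fun=> True).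

Definition ideal_colon (I : R -> Prop) (f : R) (p : R) : Prop := I (p * f).

End Ideals.

(* A monomial x^a y^b of k[x,y] is the exponent vector m : 'X_{1..2} with      *)
(* m ix = a and m iy = b; the corresponding polynomial is 'X_[m].              *)

Definition ix : 'I_2 := ord0.
Definition iy : 'I_2 := ord_max.

Section MonomialIdeals.
Variable k : fieldType.
Notation S := {mpoly k[2]}.
Notation mon := 'X_{1..2}.

Definition mon_ideal (M : mon -> Prop) : S -> Prop :=
  ideal_gen (fun p => exists2 m, M m & p = 'X_[m]).

Definition monomial_ideal (I : S -> Prop) : Prop :=
  exists M : mon -> Prop, same_ideal I (mon_ideal M).

Definition is_min_mon_gens (I : S -> Prop) (G : {fset mon}) : Prop :=
  same_ideal I (mon_ideal (fun m => m \in G)) /\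
  forall H : {fset mon}, (H `<=` G)%fset ->
    same_ideal I (mon_ideal (fun m => m \in H)) -> H = G.

(* Every monomial ideal has exactly one minimal set of monomial generators,   *)
(* and it is finite (Dickson's lemma), so epsilon selects it.                 *)
Definition mingens (I : S -> Prop) : {fset mon} :=
  epsilon (inhabits fset0) (is_min_mon_gens I).

Definition mu (I : S -> Prop) : nat := #|` mingens I|%fset.

Definition is_gcd_mon (I : S -> Prop) (d : mon) : Prop :=
  (forall m : mon, I 'X_[m] -> (d <= m)%MM) /\
  (forall e : mon, (forall m : mon, I 'X_[m] -> (e <= m)%MM) -> (e <= d)%MM).

(* Exists and is unique as soon as I contains a monomial. *)
Definition gcd_mon (I : S -> Prop) : mon :=
  epsilon (inhabits 0%MM) (is_gcd_mon I).

Definition dist (i : 'I_2) (I : S -> Prop) : nat :=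
  \max_(g <- mingens (ideal_colon I 'X_[gcd_mon I])) g i.

Definition pair_ideal (g h : mon) : S -> Prop :=
  mon_ideal (fun m => m = g \/ m = h).

Definition int_closure (I : S -> Prop) : S -> Prop :=
  mon_ideal (fun f => exists2 n : nat, (0 < n)%N & ideal_pow I n ('X_[f] ^+ n)).

Definition persistent (I : S -> Prop) (f : mon) : Prop :=
  f \in mingens I /\
  forall g h : mon, I 'X_[g] -> g <> f -> I 'X_[h] -> h <> f ->
    ~ int_closure (pair_ideal g h) 'X_[f].

Definition weakly_persistent (I : S -> Prop) (f : mon) : Prop :=
  f \in mingens I /\
  forall n : nat, (0 < n)%N -> (f *+ n)%MM \in mingens (ideal_pow I n).

(* The quantities below are integers, so that no subtraction is truncated.    *)

(* dist_i(g,h), the distance of the ideal (g,h). *)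
Definition dist2 (i : 'I_2) (g h : mon) : nat := dist i (pair_ideal g h).

(* The list of pairs (g_j, g_{j+1}), where g_1, g_2, ... enumerates P in      *)
(* descending y-degree; distinct minimal generators have distinct y-degrees.  *)
Definition consec (P : {fset mon}) : seq (mon * mon) :=
  let s := sort (fun g h : mon => h iy <= g iy)%N P in zip s (behead s).

Definition delta (P : {fset mon}) : int :=
  (\max_(u <- consec P) minn (dist2 ix u.1 u.2) (dist2 iy u.1 u.2))%N%:Z - 1.

Definition dP (I : S -> Prop) (P : {fset mon}) : int :=
  if (2 < #|` P|)%N then (minn (dist ix I) (dist iy I))%:Z - 2 else 0.

Definition DP (I : S -> Prop) (P : {fset mon}) : int :=
  ((mu I)%:Z - #|` P|%:Z) * delta P + #|` P|%:Z * dP I P.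

Definition rdir (i : 'I_2) (I : S -> Prop) (P : {fset mon}) (D : int) : int :=
  Num.ceil (D%:Q * \big[Num.max/0]_(u <- consec P)
                      ((dist i I)%:Q / (dist2 i u.1 u.2)%:Q)).

Definition rP (I : S -> Prop) (P : {fset mon}) (D : int) : int :=
  Num.min (rdir ix I P D) (rdir iy I P D).

End MonomialIdeals.

(* Main.v *)
Require Import Defs.
From mathcomp Require Import all_boot all_order all_algebra finmap zify.
From Stdlib Require Import ClassicalEpsilon.

Set Implicit Arguments.
Unset Strict Implicit.
Unset Printing Implicit Defensive.

Import Order.TTheory GRing.Theory Num.Theory.

(** Monomials of k[x,y] are identified with their exponent vectors.  If A is
    the set of exponent vectors of the minimal generators of I, the minimal
    generators of I^n are the minimal elements of the n-fold sumset of A, so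
    the theorem is about counting these minimal elements.

    Let g_0, ..., g_k be the points of P in order of increasing x.  Minimizing
    a linear form over A, with ties broken by a coordinate, gives a persistent
    generator, and a weakly persistent generator never lies strictly above a
    chord of A.  Hence P consists of points of the lower boundary of the Newton
    polygon, including all its vertices: g_0 and g_k are the extreme elements
    of A, and all of A lies on or above every line g_i g_(i+1)
    [above_edge_line, boundary_chain_vertices].

    Every minimal n-fold sum u is a sum of n elements of A of which at most D
    are different from the two ends of a single edge g_j g_(j+1)
    [factor_along_edge].  Indeed, a repeated element of A outside P can be
    traded for a sum of ends of the edge below it, and two repeated points g_i
    and g_l with l > i + 1 can be traded for a repeated g_(i+1).  A trade never
    increases the sum, so by minimality it preserves it; an extremal
    factorization admits no trade, and this bounds the exponents.

    Consequently, every minimal (n+1)-fold sum whose x-coordinate is safely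
    between those of n g_(i-1) and n g_(i+1) has g_i as a summand
    [divisible_in_window], and adding g_i is a bijection from a window of
    minimal n-fold sums onto the translated window of minimal (n+1)-fold sums
    [window_shift].  Choose on each edge a cut v_i = a g_i + b g_(i+1) with
    a + b = n, far enough from both ends; this is possible as soon as n is at
    least D + r + 1 [exists_cuts].  Adding g_i to the minimal n-fold sums
    between v_(i-1) and v_i covers all minimal (n+1)-fold sums except those
    between v_i + g_i and v_i + g_(i+1), and the number of the latter does not
    change when n increases [first_difference, difference_shift].  So the
    second difference of n |-> mu(I^n) vanishes from s on.

    The combinatorial part is stated for coordinates X and Y that are
    interchangeable, because r(P,D) is the minimum of r_x(P,D) and r_y(P,D):
    the argument is run along x or along y, according to where the minimum is
    attained. *)

(** * Exponent vectors *)

Notation mon := 'X_{1..2}.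

Lemma coord2 (X Y : 'I_2) : X != Y -> forall i, i = X \/ i = Y.
Proof. by case: X Y => [[|[|//]] ?] [[|[|//]] ?] // _ [[|[|//]] ?]; [left|right|right|left]; apply/val_inj. Qed.

Lemma mon_leE (X Y : 'I_2) (u v : mon) : X != Y ->
  (u <= v)%MM = (u X <= v X) && (u Y <= v Y).
Proof.
move=> /coord2 XY; apply/mnm_lepP/andP => [le_uv|[leX leY] i]; first by split.
by case: (XY i) => ->.
Qed.

Lemma mon_eq (X Y : 'I_2) (u v : mon) : X != Y ->
  u X = v X -> u Y = v Y -> u = v.
Proof. by move=> /coord2 XY eX eY; apply/mnmP=> i; case: (XY i) => ->. Qed.

Lemma mon_anti (u v : mon) : (u <= v)%MM -> (v <= u)%MM -> u = v.
Proof.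
move=> /mnm_lepP uv /mnm_lepP vu; apply/mnmP=> i.
by apply: anti_leq; rewrite uv vu.
Qed.

Definition minimal (S : mon -> Prop) (u : mon) : Prop :=
  S u /\ forall w, S w -> (w <= u)%MM -> w = u.

Lemma minimal_below (S : mon -> Prop) z :
  S z -> exists2 u, minimal S u & (u <= z)%MM.
Proof.
have [N] := ubnP (mdeg z); elim: N z => // N IHN z; rewrite ltnS => leN Sz.
have [[w [Sw le_wz neq_wz]]|no] :=
    classic (exists w, [/\ S w, (w <= z)%MM & w <> z]); last first.
  exists z; last exact: lepm_refl.
  by split=> // w Sw le_wz; apply: NNPP => neq; apply: no; exists w.
have [||u min_u le_uw] := IHN w => //; last first.
  by exists u => //; apply: lepm_trans le_wz.
apply: leq_trans leN; rewrite -(submK le_wz) mdegD -{1}[mdeg w]add0n ltn_add2r.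
rewrite lt0n mdeg_eq0; apply/negP => /eqP E; apply: neq_wz.
by rewrite -(submK le_wz) E add0m.
Qed.

(** * Sums of exponent vectors *)

Definition msum (s : seq mon) : mon := (\sum_(a <- s) a)%MM.

Lemma msumE s i : msum s i = \sum_(a <- s) a i.
Proof. exact: mnm_sumE. Qed.

Lemma msum_cons a s : msum (a :: s) = (a + msum s)%MM.
Proof. by rewrite /msum big_cons. Qed.

Lemma msum_cat s t : msum (s ++ t) = (msum s + msum t)%MM.
Proof. by rewrite /msum big_cat. Qed.

Lemma msum_nseq n a i : msum (nseq n a) i = n * a i.
Proof. by rewrite msumE big_nseq iter_addn_0 mulnC. Qed.

Lemma perm_msum s t : perm_eq s t -> msum s = msum t.
Proof. by move=> st; apply: perm_big. Qed.

Definition sumset (A : {fset mon}) (n : nat) (u : mon) : Prop :=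
  exists s : seq mon, [/\ {subset s <= A}, size s = n & u = msum s].

Definition minsum (A : {fset mon}) (n : nat) : mon -> Prop :=
  minimal (sumset A n).

Lemma sumsetD (A : {fset mon}) n m u v :
  sumset A n u -> sumset A m v -> sumset A (n + m) (u + v)%MM.
Proof.
move=> [s [sA <- ->]] [t [tA <- ->]]; exists (s ++ t).
split; [|by rewrite size_cat|by rewrite msum_cat].
by move=> a; rewrite mem_cat => /orP[/sA|/tA].
Qed.

Lemma sumset1 (A : {fset mon}) a : a \in A -> sumset A 1 a.
Proof.
move=> aA; exists [:: a]; split=> //; last by rewrite msum_cons /msum big_nil addm0.
by move=> b; rewrite inE => /eqP->.
Qed.

Lemma sumset_nseq (A : {fset mon}) n a : a \in A -> sumset A n (msum (nseq n a)).
Proof.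
move=> aA; exists (nseq n a); split=> //; last by rewrite size_nseq.
by move=> b /nseqP[->].
Qed.

(** A multiset s that contains a at least m times contains m copies of a as a
    sub-multiset, which can then be traded. *)
Lemma count_split (a : mon) m s :
  m <= count_mem a s -> exists s', perm_eq s (nseq m a ++ s').
Proof.
elim: m s => [|m IHm] s; first by exists s; rewrite perm_refl.
move=> lt_m; have as_ : a \in s by rewrite -has_pred1 has_count; lia.
have [|s' Hs'] := IHm (rem a s).
  by rewrite -(leq_add2l 1) (leq_trans lt_m) // (permP (perm_to_rem as_)) /= eqxx.
exists s'; apply: perm_trans (perm_to_rem as_) _.
by rewrite /= perm_cons.
Qed.

(** Replacing a part t of a factorization of a minimal sum by a part t' of the
    same size with a smaller or equal sum keeps the number of summands, so the
    new total is again a sum of n elements below a minimal one.  It follows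
    that no trade can lower the sum; it only changes the factorization. *)
Lemma msum_exchange (A : {fset mon}) n s t t' s' :
  minsum A n (msum s) -> {subset s <= A} -> size s = n -> perm_eq s (t ++ s') ->
  {subset t' <= A} -> size t' = size t -> (msum t' <= msum t)%MM ->
  msum t' = msum t.
Proof.
move=> [_ min_s] sA sz_s st t'A sz_t le_t.
have s'A a : a \in s' -> a \in A.
  by move=> as'; apply: sA; rewrite (perm_mem st) mem_cat as' orbT.
have: msum (t' ++ s') = msum s.
  apply: min_s.
    exists (t' ++ s'); split=> //; last first.
      by rewrite -sz_s (perm_size st) !size_cat sz_t.
    by move=> a; rewrite mem_cat => /orP[/t'A|/s'A].
  rewrite (perm_msum st) !msum_cat; apply/mnm_lepP=> i.
  by rewrite !mnmDE leq_add2r; move/mnm_lepP: le_t.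
by rewrite (perm_msum st) !msum_cat => /(congr1 (fun m => m - msum s')%MM); rewrite !addmK.
Qed.

Lemma count_sum (A : {fset mon}) (Q : pred mon) s :
  {subset s <= A} -> count Q s = \sum_(a <- A | Q a) count_mem a s.
Proof.
elim: s => [_|b s IHs sA] /=; first by rewrite big1.
rewrite big_split /= -IHs; last by move=> a as_; apply: sA; rewrite inE as_ orbT.
congr (_ + _); have bA : b \in A by apply: sA; rewrite inE eqxx.
rewrite big_mkcond /= (big_rem b) //= eqxx.
rewrite big1_seq => [|a]; first by case: (Q b).
rewrite /= mem_rem_uniq ?fset_uniq // inE => /andP[/negbTE ab _].
by rewrite eq_sym ab if_same.
Qed.

(** * Factorizations of minimal sums *)

(** Each trade of copies of an element outside P for elements of P lowers the
    number of summands outside P, so trading stops, and it can only stop when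
    every such element has become rare. *)
Lemma bound_non_P (A P : {fset mon}) n u e :
  {subset P <= A} -> minsum A n u ->
  (forall a, a \in A -> a \notin P -> exists t,
     [/\ {subset t <= P}, 0 < size t <= e & (msum t <= msum (nseq (size t) a))%MM]) ->
  exists s, [/\ {subset s <= A}, size s = n, u = msum s
    & forall a, a \in A -> a \notin P -> count_mem a s < e].
Proof.
move=> PA min_u exP; have [[s [sA sz_s def_u]] _] := min_u.
have [N leN] := ubnP (count (fun a => a \notin P) s).
elim: N s sA sz_s def_u leN => // N IHN s sA sz_s def_u; rewrite ltnS => leN.
have [/allP small|/allPn[a]] :=
  boolP (all (fun a => (a \in P) || (count_mem a s < e)) A).
  by exists s; split=> // a aA /negbTE aP; have:= small a aA; rewrite aP.
move=> aA; rewrite negb_or -leqNgt => /andP[aP large].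
have [t [tP /andP[t_gt0 le_t] le_sum]] := exP a aA aP.
have [s' st] := count_split (leq_trans le_t large).
have tA b : b \in t -> b \in A by move/tP/PA.
have eq_t : msum t = msum (nseq (size t) a).
  by apply: (msum_exchange _ sA sz_s st tA); rewrite -?def_u ?size_nseq.
apply: (IHN (t ++ s')).
- move=> b; rewrite mem_cat => /orP[/tA //|bs'].
  by apply: sA; rewrite (perm_mem st) mem_cat bs' orbT.
- by rewrite -sz_s (perm_size st) !size_cat size_nseq.
- by rewrite def_u (perm_msum st) !msum_cat eq_t.
apply: leq_trans leN; rewrite (permP st) !count_cat ltn_add2r.
rewrite count_nseq aP mul1n; apply: leq_ltn_trans t_gt0.
by rewrite leqn0 -[_ == 0]negbK -lt0n -has_count; apply/hasPn => b /tP; rewrite negbK.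
Qed.

(** Strict convexity of the square, cleared of denominators: it makes the sum
    of squares of the x-coordinates decrease when two distant points of P are
    traded for copies of a point between them. *)
Lemma strict_convexity a b p q r :
  0 < a -> 0 < b -> p < q -> (a + b) * r = a * p + b * q ->
  (a + b) * r ^ 2 < a * p ^ 2 + b * q ^ 2.
Proof.
move=> a0 b0 pq E.
have pr : p < r by nia.
have rq : r < q by nia.
have [c Ec] : exists c, r = p + c by exists (r - p); lia.
have [d Ed] : exists d, q = r + d by exists (q - r); lia.
subst r q; have Ecd : a * c = b * d by nia.
have -> : (a + b) * (p + c) ^ 2 =
          (a + b) * p ^ 2 + 2 * p * (a * c + b * c) + (a * c + b * c) * c by nia.
have -> : a * p ^ 2 + b * (p + c + d) ^ 2 =
  (a + b) * p ^ 2 + 2 * p * (b * c + b * d) + (b * d + b * c) * (c + d) by nia.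
rewrite Ecd; have : 0 < b * d by nia.
nia.
Qed.

(** Trading two distant points of P for an intermediate one keeps the sum, hence
    also the sum of the x-coordinates, and strictly lowers the sum of their
    squares.  So the process terminates, and in the end no two points of P with
    indices at distance at least 2 both occur e times.  Summands outside P are
    left alone, which preserves the bound obtained for them. *)
Lemma concentrate_P (A : {fset mon}) (X : 'I_2) (g : nat -> mon) k n s e :
  (forall i, i <= k -> g i \in A) ->
  (forall i l, i < l -> l <= k -> g i X < g l X) ->
  {subset s <= A} -> size s = n -> minsum A n (msum s) ->
  (forall i l, i.+1 < l -> l <= k -> exists j a b,
    [/\ j <= k, 0 < a <= e, 0 < b <= e
      & (msum (nseq (a + b) (g j)) <= msum (nseq a (g i) ++ nseq b (g l)))%MM]) ->
  exists s', [/\ {subset s' <= A}, size s' = n, msum s = msum s',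
     forall a, (forall i, i <= k -> g i != a) -> count_mem a s' = count_mem a s
   & forall i l, i.+1 < l -> l <= k ->
       count_mem (g i) s' < e \/ count_mem (g l) s' < e].
Proof.
move=> gA g_incr sA sz_s min_s exch.
have [N leN] := ubnP (\sum_(a <- s) (a X) ^ 2).
elim: N s sA sz_s min_s leN => // N IHN s sA sz_s min_s; rewrite ltnS => leN.
pose bad i l := [&& i.+1 < l, e <= count_mem (g i) s & e <= count_mem (g l) s].
have [/'exists_existsP[i [l bad_il]]|noex] :=
    boolP [exists i : 'I_k.+1, exists l : 'I_k.+1, bad i l]; last first.
  exists s; split=> // i l il lk; rewrite !ltnNge; apply/orP.
  rewrite -negb_and; apply: contra noex => H.
  have ik : i < k.+1 by lia.
  apply/'exists_existsP; exists (Ordinal ik), (Ordinal (lk : l < k.+1)).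
  by rewrite /bad /= il.
case/and3P: bad_il => il lei lel.
have lk : l <= k by rewrite -ltnS.
have ik : i <= k by rewrite -ltnS.
have [j [a [b [jk /andP[a0 ae] /andP[b0 be] le_sum]]]] := exch _ _ il lk.
have neq_il : g i != g l.
  by apply/eqP => E; have := g_incr i l (ltnW il) lk; rewrite E ltnn.
have [s1 s1P] := count_split (leq_trans ae lei).
have [s2 s2P] : exists s2, perm_eq s1 (nseq b (g l) ++ s2).
  apply: count_split; apply: leq_trans be (leq_trans lel _).
  by rewrite (permP s1P) count_cat count_nseq /= (negbTE neq_il).
have st : perm_eq s ((nseq a (g i) ++ nseq b (g l)) ++ s2).
  by apply: perm_trans s1P _; rewrite -catA perm_cat2l.
have tA c : c \in nseq (a + b) (g j) -> c \in A by move/nseqP=> [-> _]; apply: gA.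
have eq_t := msum_exchange min_s sA sz_s st tA
  (etrans (size_nseq _ _) (esym (etrans (size_cat _ _)
     (congr2 addn (size_nseq _ _) (size_nseq _ _))))) le_sum.
have eq_s : msum s = msum (nseq (a + b) (g j) ++ s2).
  by rewrite (perm_msum st) !(msum_cat _ s2) eq_t.
have lt_sq : \sum_(c <- nseq (a + b) (g j) ++ s2) (c X) ^ 2 < N.
  apply: leq_trans leN; rewrite (perm_big _ st) /= !big_cat /= ltn_add2r.
  rewrite !big_nseq !iter_addn_0 ![_ ^ 2 * _]mulnC; apply: strict_convexity => //.
    exact/g_incr/lk/ltnW.
  by move/(congr1 (fun m : mon => m X)): eq_t; rewrite msum_cat mnmDE !msum_nseq.
have [||||s' [s'A sz_s' eq_s' count_s' conc]] := IHN (nseq (a + b) (g j) ++ s2).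
- move=> c; rewrite mem_cat => /orP[/tA //|cs2].
  by apply: sA; rewrite (perm_mem st) mem_cat cs2 orbT.
- by rewrite -sz_s (perm_size st) !size_cat !size_nseq.
- by rewrite -eq_s.
- exact: lt_sq.
exists s'; split=> //; first by rewrite eq_s.
move=> c cP; rewrite count_s' // (permP st) !count_cat !count_nseq /=.
by rewrite !(negbTE (cP _ _)).
Qed.

(** * Points on the lower boundary of the Newton polygon *)

Lemma step_trans (r : rel nat) (F : nat -> nat) k : transitive r ->
  (forall i, i < k -> r (F i) (F i.+1)) ->
  forall i l, i < l -> l <= k -> r (F i) (F l).
Proof.
move=> r_trans step i; elim=> // l IHl; rewrite ltnS leq_eqVlt.
move=> /predU1P[-> | il] lk; first exact: step.
exact: r_trans (IHl il (ltnW lk)) (step l lk).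
Qed.

(** The situation to which the hypotheses on P are reduced: g_0, ..., g_k go down
    from the X-smallest to the X-largest element of the antichain A, and the
    last field says that A lies on or above the line through g_i and g_(i+1),
    whose equation is multiplied by the two positive side lengths. *)
Record boundary_chain (X Y : 'I_2) (A : {fset mon}) (g : nat -> mon) (k : nat)
    : Prop := BoundaryChain {
  chain_coord : X != Y;
  chain_gt0 : 0 < k;
  chain_anti : forall a b, a \in A -> b \in A -> (a <= b)%MM -> a = b;
  chain_sub : forall i, i <= k -> g i \in A;
  chain_stepX : forall i, i < k -> g i X < g i.+1 X;
  chain_stepY : forall i, i < k -> g i.+1 Y < g i Y;
  chain_ext : forall a, a \in A -> g 0 X <= a X <= g k X;
  chain_edge : forall i a, i < k -> a \in A ->
    (g i Y - g i.+1 Y) * g i X + (g i.+1 X - g i X) * g i Y <=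
    (g i Y - g i.+1 Y) * a X + (g i.+1 X - g i X) * a Y }.

Section Chain.
Variables (X Y : 'I_2) (A : {fset mon}) (g : nat -> mon) (k : nat).
Hypothesis C : boundary_chain X Y A g k.
Let XY := chain_coord C.

Lemma chain_ltX i l : i < l -> l <= k -> g i X < g l X.
Proof. exact: (step_trans (F := fun j => g j X) ltn_trans (chain_stepX C)). Qed.

Lemma chain_ltY i l : i < l -> l <= k -> g l Y < g i Y.
Proof.
apply: (step_trans (r := fun a b => b < a) (F := fun j => g j Y)).
  by move=> b a c ba cb; apply: ltn_trans cb ba.
exact: (chain_stepY C).
Qed.

Lemma chain_leX i l : i <= l -> l <= k -> g i X <= g l X.
Proof. by rewrite leq_eqVlt => /predU1P[-> // | il /(chain_ltX il)/ltnW]. Qed.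

Lemma chain_leY i l : i <= l -> l <= k -> g l Y <= g i Y.
Proof. by rewrite leq_eqVlt => /predU1P[-> // | il /(chain_ltY il)/ltnW]. Qed.

Lemma chain_between a : a \in A -> exists i,
  [/\ i < k, g i X <= a X <= g i.+1 X & g i.+1 Y <= a Y <= g i Y].
Proof.
move=> aA; have /andP[lo hi] := chain_ext C aA.
have [i ik /andP[l1 l2]] : exists2 i, i < k & g i X <= a X <= g i.+1 X.
  suff H m : 0 < m -> m <= k -> a X <= g m X ->
      exists2 i, i < m & g i X <= a X <= g i.+1 X.
    exact: H (chain_gt0 C) (leqnn k) hi.
  elim: m => // m IHm _ mk le_m.
  have [le|lt] := leqP (g m X) (a X); first by exists m; rewrite ?le.
  case: m IHm mk le_m lt => [|m] IHm mk le_m lt; first by lia.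
  by have [i im ?] := IHm isT (ltnW mk) (ltnW lt); exists i => //; apply: ltnW.
have giA := chain_sub C (ltnW ik); have gjA := chain_sub C ik.
exists i; split=> //; first by rewrite l1.
have anti b c : b \in A -> c \in A -> b X <= c X -> c Y <= b Y.
  move=> bA cA bc; rewrite leqNgt; apply/negP => lt.
  have E : b = c by apply: (chain_anti C) => //; rewrite (mon_leE _ _ XY) bc ltnW.
  by rewrite E ltnn in lt.
by rewrite !anti.
Qed.

Lemma le_msum_seq2 m a b (p q r : mon) :
  m * p X <= a * q X + b * r X -> m * p Y <= a * q Y + b * r Y ->
  (msum (nseq m p) <= msum (nseq a q ++ nseq b r))%MM.
Proof. by rewrite (mon_leE _ _ XY) msum_cat !mnmDE !msum_nseq => -> ->. Qed.

Lemma ge_msum_seq2 m a b (p q r : mon) :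
  a * q X + b * r X <= m * p X -> a * q Y + b * r Y <= m * p Y ->
  (msum (nseq a q ++ nseq b r) <= msum (nseq m p))%MM.
Proof. by rewrite (mon_leE _ _ XY) msum_cat !mnmDE !msum_nseq => -> ->. Qed.

(** Let w and h be the side lengths of the edge under a.  Then w a has the same
    X-coordinate as a combination of w ends of the edge and lies above it, and
    h a has the same Y-coordinate as a combination of h ends and lies to the
    right of it; the shorter of the two trades is chosen. *)
Lemma above_edge a : a \in A -> exists i t, [/\ i < k,
  {subset t <= [:: g i; g i.+1]},
  size t = minn (g i.+1 X - g i X) (g i Y - g i.+1 Y)
  & (msum t <= msum (nseq (size t) a))%MM].
Proof.
move=> aA; have [i [ik /andP[x1 x2] /andP[y1 y2]]] := chain_between aA.
have := chain_edge C ik aA; have := chain_stepX C ik; have := chain_stepY C ik.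
have [p Ep] : exists p, p = g i by eexists.
have [q Eq] : exists q, q = g i.+1 by eexists.
rewrite -Ep -Eq in x1 x2 y1 y2 *; pose t m1 m2 := nseq m1 p ++ nseq m2 q.
have tP m1 m2 : {subset t m1 m2 <= [:: p; q]}.
  by move=> b; rewrite mem_cat !inE => /orP[]/nseqP[-> _]; rewrite eqxx ?orbT.
have sz_t m1 m2 : size (t m1 m2) = m1 + m2 by rewrite size_cat !size_nseq.
move=> ltY ltX.
have [w Ew] : exists w, w = q X - p X by eexists.
have [h Eh] : exists h, h = p Y - q Y by eexists.
rewrite -Ew -Eh => edge.
have [c Ec] : exists c, a X = p X + c by exists (a X - p X); lia.
have [c' Ec'] : exists c', w = c + c' by exists (q X - a X); lia.
have [d Ed] : exists d, p Y = a Y + d by exists (p Y - a Y); lia.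
have [d' Ed'] : exists d', h = d + d' by exists (a Y - q Y); lia.
have EqX : q X = p X + w by lia.
have EpY : a Y = q Y + d' by lia.
have [wh|hw] := leqP w h.
  exists i, (t c' c); rewrite sz_t -Ep -Eq; split=> //; first by lia.
  by apply: ge_msum_seq2; nia.
exists i, (t d' d); rewrite sz_t -Ep -Eq; split=> //; first by lia.
by apply: ge_msum_seq2; nia.
Qed.

(** The point g_(i+1) lies under the chord g_i g_l.  The coefficients can be
    taken as differences of X-coordinates or of Y-coordinates; each of them is
    smaller than the extent of A in that direction. *)
Lemma below_chord i l e : i.+1 < l -> l <= k ->
  minn (g k X - g 0 X) (g 0 Y - g k Y) <= e.+1 ->
  exists j a b, [/\ j <= k, 0 < a <= e, 0 < b <= e
    & (msum (nseq (a + b) (g j)) <= msum (nseq a (g i) ++ nseq b (g l)))%MM].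
Proof.
move=> il lk le_e; have ik : i < k by lia.
have ltX := chain_stepX C ik; have ltY := chain_stepY C ik.
have ltX' := chain_ltX il lk; have ltY' := chain_ltY il lk.
have X0 : g 0 X <= g i X by apply: chain_leX; lia.
have Xk : g l X <= g k X by apply: chain_leX; lia.
have Y0 : g i Y <= g 0 Y by apply: chain_leY; lia.
have Yk : g k Y <= g l Y by apply: chain_leY; lia.
have := chain_edge C ik (chain_sub C lk).
have [w Ew] : exists w, g i.+1 X = g i X + w by exists (g i.+1 X - g i X); lia.
have [h Eh] : exists h, g i Y = g i.+1 Y + h by exists (g i Y - g i.+1 Y); lia.
have [w' Ew'] : exists w', g l X = g i.+1 X + w' by exists (g l X - g i.+1 X); lia.
have [h' Eh'] : exists h', g i.+1 Y = g l Y + h' by exists (g i.+1 Y - g l Y); lia.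
have -> : g i.+1 X - g i X = w by lia.
have -> : g i Y - g i.+1 Y = h by lia.
move=> edge.
have [wh|hw] := leqP (g k X - g 0 X) (g 0 Y - g k Y).
  by exists i.+1, w', w; split; [lia|lia|lia|apply: le_msum_seq2; nia].
by exists i.+1, h', h; split; [lia|lia|lia|apply: le_msum_seq2; nia].
Qed.

(** After all trades, each element of A outside P occurs at most delta times,
    and the points of P that occur more than d times have indices in some
    {j, j+1}.  The remaining summands number at most
    (mu - |P|) delta + |P| d. *)
Lemma factor_along_edge (P : {fset mon}) (delta d D n : nat) u :
  (forall a, reflect (exists2 i, i <= k & a = g i) (a \in P)) ->
  (forall i, i < k -> minn (g i.+1 X - g i X) (g i Y - g i.+1 Y) <= delta.+1) ->
  (1 < k -> minn (g k X - g 0 X) (g 0 Y - g k Y) <= d.+2) ->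
  (#|` A| - #|` P|) * delta + #|` P| * d <= D ->
  minsum A n u ->
  exists s j, [/\ {subset s <= A}, size s = n, u = msum s, j < k
    & count (fun a => (a != g j) && (a != g j.+1)) s <= D].
Proof.
move=> PP le_delta le_d le_D min_u.
have PA : {subset P <= A} by move=> a /PP[i ik ->]; apply: (chain_sub C) ik.
have [|s [sA sz_s def_u small_nonP]] := @bound_non_P A P n u delta.+1 PA min_u.
  move=> a aA _; have [i [t [ik tP sz_t le_t]]] := above_edge aA.
  exists t; split=> //; last first.
    by rewrite sz_t le_delta // leq_min !subn_gt0 (chain_stepX C) ?(chain_stepY C).
  by move=> b /tP; rewrite !inE => /orP[]/eqP->; apply/PP; [exists i => //; lia|exists i.+1].
rewrite {}def_u in min_u *.
have [|s' [s'A sz_s' eq_s' nonP conc]] :=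
  concentrate_P (e := d.+1) (chain_sub C) (fun i l il => chain_ltX il) sA sz_s min_u.
  by move=> i l il lk; apply: below_chord => //; apply: le_d; lia.
have [j jk small] : exists2 j, j < k & forall i, i <= k -> i != j -> i != j.+1 ->
    count_mem (g i) s' <= d.
  (* The smallest frequent index is taken as j, but k - 1 if it is k itself, so
     that g_(j+1) exists. *)
  pose big i := (i <= k) && (d < count_mem (g i) s').
  have k0 := chain_gt0 C.
  have [[i0 big0]|nobig] := classic (exists i, big i); last first.
    exists 0 => // i ik _ _; rewrite leqNgt; apply/negP => bi; apply: nobig.
    by exists i; apply/andP.
  have [m /andP[mk big_m] min_m] := ex_minnP (ex_intro _ i0 big0).
  exists (minn m k.-1); first by lia.
  move=> i ik neq1 neq2; rewrite leqNgt; apply/negP => bi.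
  have mi : m <= i by apply: min_m; apply/andP.
  have mi1 : m.+1 < i by lia.
  by case: (conc _ _ mi1 ik); lia.
exists s', j; split=> //.
rewrite (count_sum _ s'A) big_mkcond /=.
apply: leq_trans le_D.
have -> : (#|` A| - #|` P|) * delta + #|` P| * d =
    \sum_(a <- A) (if a \in P then d else delta).
  have cP : count (mem P) A = #|` P|.
    rewrite -size_filter; apply/perm_size/uniq_perm => [||a].
    - exact/filter_uniq/fset_uniq.
    - exact: fset_uniq.
    - by rewrite mem_filter; apply: andb_idr => /PA.
  rewrite (bigID (mem P)) /= addnC; congr (_ + _).
    rewrite -big_filter (eq_big_seq (fun _ => d)) => [|a]; last first.
      by rewrite mem_filter => /andP[->].
    by rewrite big_const_seq count_predT size_filter iter_addn_0 cP mulnC.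
  rewrite -big_filter (eq_big_seq (fun _ => delta)) => [|a]; last first.
    by rewrite mem_filter => /andP[/negbTE->].
  rewrite big_const_seq count_predT size_filter iter_addn_0 mulnC; congr (_ * _).
  by rewrite -cP -(count_predC (mem P) A) addKn.
rewrite big_seq [leqRHS]big_seq; apply: leq_sum => a aA.
case: ifP => // /andP[a1 a2]; case: ifPn => [/PP[i ik Ea]|aP].
  rewrite Ea; apply: small ik _ _.
    by apply: contraNneq a1 => <-; rewrite Ea.
  by apply: contraNneq a2 => <-; rewrite Ea.
rewrite nonP; first exact: small_nonP.
by move=> i ik; apply: contraNneq aP => <-; apply/PP; exists i.
Qed.

End Chain.

(** * Counting minimal sums *)

Lemma sum_lower (X : 'I_2) (Q : pred mon) (s : seq mon) D l0 l1 :
  count Q s <= D -> l0 <= l1 -> (forall a, a \in s -> l0 <= a X) ->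
  (forall a, a \in s -> ~~ Q a -> l1 <= a X) ->
  size s * l1 + D * l0 <= msum s X + D * l1.
Proof.
move=> le_D le_l lo hi.
suff H : size s * l1 + count Q s * l0 <= msum s X + count Q s * l1 by nia.
elim: s lo hi {le_D} => [|a s IHs] lo hi /=; first by rewrite !mul0n leq_addl.
have tl b : b \in s -> b \in a :: s := @mem_behead _ (a :: s) b.
have := IHs (fun b bs => lo b (tl b bs)) (fun b bs => hi b (tl b bs)).
rewrite msum_cons mnmDE; have := lo a (mem_head _ _).
by have := hi a (mem_head _ _); case: (Q a) => /= [_|/(_ isT)]; nia.
Qed.

Lemma sum_upper (X : 'I_2) (Q : pred mon) (s : seq mon) D l0 l1 :
  count Q s <= D -> l0 <= l1 -> (forall a, a \in s -> a X <= l1) ->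
  (forall a, a \in s -> ~~ Q a -> a X <= l0) ->
  msum s X + D * l0 <= size s * l0 + D * l1.
Proof.
move=> le_D le_l hi lo.
suff H : msum s X + count Q s * l0 <= size s * l0 + count Q s * l1 by nia.
elim: s lo hi {le_D} => [|a s IHs] lo hi /=; first by rewrite msumE big_nil.
have tl b : b \in s -> b \in a :: s := @mem_behead _ (a :: s) b.
have := IHs (fun b bs => lo b (tl b bs)) (fun b bs => hi b (tl b bs)).
rewrite msum_cons mnmDE; have := hi a (mem_head _ _).
by have := lo a (mem_head _ _); case: (Q a) => /= [_|/(_ isT)]; nia.
Qed.

Section Counting.
Variables (X Y : 'I_2) (A : {fset mon}) (g : nat -> mon) (k : nat).
Hypothesis C : boundary_chain X Y A g k.
Let XY := chain_coord C.

Lemma edge_lower i n z : i < k -> sumset A n z ->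
  n * ((g i Y - g i.+1 Y) * g i X + (g i.+1 X - g i X) * g i Y) <=
  (g i Y - g i.+1 Y) * z X + (g i.+1 X - g i X) * z Y.
Proof.
move=> ik [s [sA <- ->]]; elim: s sA => [|a s IHs] sA; first by rewrite mul0n.
rewrite msum_cons !mnmDE !mulnDr.
have := IHs (fun b bs => sA b (@mem_behead _ (a :: s) b bs)).
have := chain_edge C ik (sA a (mem_head _ _)).
rewrite /=; lia.
Qed.

Definition edge_sum i a b := msum (nseq a (g i) ++ nseq b (g i.+1)).

Lemma edge_sumE i a b Z : edge_sum i a b Z = a * g i Z + b * g i.+1 Z.
Proof. by rewrite /edge_sum msum_cat mnmDE !msum_nseq. Qed.

Lemma edge_sumDl i a b : (edge_sum i a b + g i)%MM = edge_sum i a.+1 b.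
Proof. by apply/mnmP=> Z; rewrite mnmDE !edge_sumE mulSn; lia. Qed.

Lemma edge_sumDr i a b : (edge_sum i a b + g i.+1)%MM = edge_sum i a b.+1.
Proof. by apply/mnmP=> Z; rewrite mnmDE !edge_sumE mulSn; lia. Qed.

(** Sums of the two ends of an edge attain the minimum n c of the strictly
    increasing linear form of that edge on n-fold sums. *)
Lemma minsum_edge i a b : i < k -> minsum A (a + b) (edge_sum i a b).
Proof.
move=> ik; have ltX := chain_stepX C ik; have ltY := chain_stepY C ik.
split.
  rewrite /edge_sum msum_cat; apply: sumsetD; apply: sumset_nseq; apply: (chain_sub C); lia.
move=> z Sz; rewrite (mon_leE _ _ XY) !edge_sumE => /andP[leX leY].
have := edge_lower ik Sz.
have [w Ew] : exists w, g i.+1 X = g i X + w by exists (g i.+1 X - g i X); lia.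
have [h Eh] : exists h, g i Y = g i.+1 Y + h by exists (g i Y - g i.+1 Y); lia.
have -> : g i.+1 X - g i X = w by lia.
have -> : g i Y - g i.+1 Y = h by lia.
have w0 : 0 < w by lia.
have h0 : 0 < h by lia.
have [x Ex] : exists x, a * g i X + b * g i.+1 X = z X + x.
  by exists (a * g i X + b * g i.+1 X - z X); lia.
have [y Ey] : exists y, a * g i Y + b * g i.+1 Y = z Y + y.
  by exists (a * g i Y + b * g i.+1 Y - z Y); lia.
move=> low; have : h * x + w * y <= 0.
  rewrite -(leq_add2l (h * z X + w * z Y)) addn0; apply: leq_trans low.
  rewrite addnACA -!mulnDr -Ex -Ey Ew Eh; nia.
rewrite leqn0 addn_eq0 !muln_eq0 (gtn_eqF w0) (gtn_eqF h0) /= => /andP[/eqP x0 /eqP y0].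
by apply: (mon_eq XY); rewrite edge_sumE; lia.
Qed.

Variables (G : nat -> {fset mon}) (D : nat).
Hypothesis GE : forall n u, u \in G n <-> minsum A n u.
Hypothesis factor : forall n u, minsum A n u -> exists s j,
  [/\ {subset s <= A}, size s = n, u = msum s, j < k
    & count (fun a => (a != g j) && (a != g j.+1)) s <= D].

(** Up to D summands, u is a combination of g_j and g_(j+1).  If g_i is not
    among the summands, then either j >= i and all but D summands are at least
    as far right as g_(i+1), or j < i and all but D summands are at most as far
    right as g_(i-1); both are excluded by the position of u. *)
Lemma divisible_in_window n u i : i <= k -> u \in G n.+1 ->
  (i < k -> u X + D * g i.+1 X < n.+1 * g i.+1 X + D * g 0 X) ->
  (0 < i -> n.+1 * g i.-1 X + D * g k X < u X + D * g i.-1 X) ->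
  exists2 u', sumset A n u' & u = (u' + g i)%MM.
Proof.
move=> ik /GE/factor[s [j [sA sz_s -> jk few]]] right left.
have ext a : a \in s -> g 0 X <= a X <= g k X by move/sA/(chain_ext C).
have [gis|gis] := boolP (g i \in s).
  exists (msum (rem (g i) s)).
    exists (rem (g i) s); split=> //; last by rewrite size_rem // sz_s.
    by move=> a /mem_rem/sA.
  by rewrite (perm_msum (perm_to_rem gis)) msum_cons addmC.
have neq a : a \in s -> a != g i by apply: contraTneq => ->.
have [ij|ji] := leqP i j.
  have ik' : i < k := leq_ltn_trans ij jk; have := right ik'.
  rewrite ltnNge => /negP[]; rewrite -sz_s; apply: sum_lower few _ _ _.
  - exact: chain_leX C _ _ _ _.
  - by move=> a /ext/andP[].
  move=> a /neq ai; rewrite negb_and !negbK => /orP[]/eqP Ea.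
    rewrite Ea; apply: (chain_leX C); last exact: ltnW.
    by rewrite ltn_neqAle ij andbT; apply: contraNneq ai => ->; rewrite Ea.
  by rewrite Ea; apply: (chain_leX C).
have i0 : 0 < i by lia.
have := left i0; rewrite ltnNge => /negP[]; rewrite -sz_s; apply: sum_upper few _ _ _.
- by apply: (chain_leX C); lia.
- by move=> a /ext/andP[].
move=> a /neq ai; rewrite negb_and !negbK => /orP[]/eqP Ea.
  by rewrite Ea; apply: (chain_leX C); lia.
rewrite Ea; apply: (chain_leX C); last by lia.
have : j.+1 != i by apply: contraNneq ai => <-; rewrite Ea.
lia.
Qed.

Definition window_count n p q := count (fun u : mon => p <= u X < q) (G n).
Definition count_left n q := count (fun u : mon => u X < q) (G n).

Lemma count_leftD n p q : p <= q -> count_left n q = count_left n p + window_count n p q.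
Proof.
move=> pq; rewrite /count_left /window_count; elim: (enum_fset (G n)) => //= u s ->.
by case: (ltnP (u X) p) => /=; lia.
Qed.

Lemma minsum_anti n u v : minsum A n u -> minsum A n v ->
  u X < v X -> v Y < u Y.
Proof.
move=> [Su _] [_ minv] lt; rewrite ltnNge; apply/negP => le.
suff E : u = v by rewrite E ltnn in lt.
by apply: minv => //; rewrite (mon_leE _ _ XY) (ltnW lt).
Qed.

Lemma minsum_cancel n u v : sumset A n u -> minsum A n.+1 (u + v)%MM ->
  v \in A -> minsum A n u.
Proof.
move=> Su [_ min_uv] vA; split=> // w Sw le_wu.
suff /(congr1 (fun m => m - v)%MM) : (w + v = u + v)%MM by rewrite !addmK.
apply: min_uv; first by rewrite -addn1; apply/sumsetD/sumset1.
by apply/mnm_lepP=> i; rewrite !mnmDE leq_add2r; move/mnm_lepP: le_wu.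
Qed.

(** Adding g_i maps the minimal n-fold sums with X-coordinate in [p, q) onto the
    minimal (n+1)-fold sums with X-coordinate in the translated window.  The
    delicate point is that u' + g_i stays minimal: something below it either
    lies in the window, and then g_i can be cancelled, or lies to the left of
    the window, and then it is higher than v + g_i, which in turn is at least
    as high as u' + g_i.  This is why the window has to start at a minimal sum
    v for which v + g_i is minimal too. *)
Lemma window_shift n i p q v : i <= k ->
  minsum A n v -> v X = p -> minsum A n.+1 (v + g i)%MM ->
  (forall u, u \in G n.+1 -> p + g i X <= u X < q + g i X ->
    exists2 u', sumset A n u' & u = (u' + g i)%MM) ->
  window_count n.+1 (p + g i X) (q + g i X) = window_count n p q.
Proof.
move=> ik min_v vX min_vg window; have giA := chain_sub C ik.
rewrite /window_count -!size_filter.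
pose f (u : mon) := (u + g i)%MM.
have f_inj : injective f by move=> a b /(congr1 (fun m => m - g i)%MM); rewrite !addmK.
rewrite -[RHS](size_map f); apply/perm_size/uniq_perm.
- exact/filter_uniq/fset_uniq.
- by rewrite map_inj_uniq //; apply/filter_uniq/fset_uniq.
move=> u; rewrite mem_filter; apply/andP/mapP => [[rg_u uG]|[u']].
  have [u' Su' Eu] := window u uG rg_u; exists u' => //.
  rewrite mem_filter; apply/andP; split.
    by move: rg_u; rewrite Eu mnmDE leq_add2r ltn_add2r.
  by apply/GE/(minsum_cancel Su' _ giA); rewrite -Eu; apply/GE.
rewrite mem_filter => /andP[/andP[pu uq] /GE min_u] ->; split.
  by rewrite mnmDE leq_add2r ltn_add2r pu.
have Sf : sumset A n.+1 (f u').
  by rewrite -addn1; apply/sumsetD/sumset1 => //; case: min_u.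
have [z min_z le_z] := minimal_below Sf.
suff <- : z = f u' by apply/GE.
move: (le_z); rewrite (mon_leE _ _ XY) !mnmDE => /andP[leX leY].
have [le_p|lt_p] := leqP (p + g i X) (z X).
  have [|z' Sz' Ez] := window z (proj2 (GE _ _) min_z); first by lia.
  rewrite Ez; congr (_ + _)%MM; case: min_u => _; apply=> //.
  apply/mnm_lepP => Z; move/mnm_lepP: le_z => /(_ Z).
  by rewrite Ez !mnmDE leq_add2r.
have := minsum_anti min_z min_vg; rewrite !mnmDE vX => /(_ lt_p) ltY.
have : u' Y <= v Y; last by lia.
rewrite leqNgt; apply/negP => lt_Y.
case: min_u => _ /(_ v); rewrite (mon_leE _ _ XY) vX pu (ltnW lt_Y) => /(_ min_v.1 isT) E.
by rewrite E ltnn in lt_Y.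
Qed.

(** On edge i the cut is al_i g_i + be_i g_(i+1); its distance along
    X to n g_(i+1) is at least, and its distance to n g_i more than, what D
    arbitrary summands can make up for. *)
Definition cuts n (al be : nat -> nat) := forall i, i < k ->
  [/\ al i + be i = n, D * (g i.+1 X - g 0 X) <= al i * (g i.+1 X - g i X)
    & D * (g k X - g i X) < be i * (g i.+1 X - g i X)].

Definition cut (al be : nat -> nat) i := al i * g i X + be i * g i.+1 X.

Lemma cut_right n al be i u : cuts n al be -> i < k ->
  u < cut al be i + g i X -> u + D * g i.+1 X < n.+1 * g i.+1 X + D * g 0 X.
Proof.
move=> cutP ik; have [<- hal _] := cutP i ik; rewrite /cut.
have [w Ew] : exists w, g i.+1 X = g i X + w.
  by exists (g i.+1 X - g i X); have := chain_stepX C ik; lia.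
have [b Eb] : exists b, g i X = g 0 X + b.
  by exists (g i X - g 0 X); have := chain_leX C (leq0n i) (ltnW ik); lia.
move: hal; have -> : g i.+1 X - g i X = w by lia.
have -> : g i.+1 X - g 0 X = b + w by lia.
rewrite Ew Eb; nia.
Qed.

Lemma cut_left n al be i u : cuts n al be -> i < k ->
  cut al be i + g i.+1 X <= u -> n.+1 * g i X + D * g k X < u + D * g i X.
Proof.
move=> cutP ik; have [<- _ hbe] := cutP i ik; rewrite /cut.
have [w Ew] : exists w, g i.+1 X = g i X + w.
  by exists (g i.+1 X - g i X); have := chain_stepX C ik; lia.
have [c Ec] : exists c, g k X = g i X + c.
  by exists (g k X - g i X); have := chain_leX C (ltnW ik) (leqnn k); lia.
move: hbe; have -> : g i.+1 X - g i X = w by lia.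
have -> : g k X - g i X = c by lia.
rewrite Ew Ec; nia.
Qed.

Lemma cuts_succ n al be : cuts n al be -> cuts n.+1 (fun i => (al i).+1) be.
Proof.
by move=> cutP i ik; have [E1 E2 E3] := cutP i ik; split=> //; nia.
Qed.

Lemma G_range n u : u \in G n -> n * g 0 X <= u X <= n * g k X.
Proof.
move=> /GE[[s [sA <- ->]] _].
have ext a : a \in s -> g 0 X <= a X <= g k X by move/sA/(chain_ext C).
have := @sum_lower X pred0 s 0 (g 0 X) (g 0 X); rewrite count_pred0 !addn0 => -> //.
  have := @sum_upper X pred0 s 0 (g k X) (g k X); rewrite count_pred0 !addn0 => -> //.
  - by move=> a /ext/andP[].
  - by move=> a /ext/andP[].
- by move=> a /ext/andP[].
- by move=> a /ext/andP[].
Qed.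

Lemma cut_range n al be i : cuts n al be -> i < k ->
  n * g i X <= cut al be i <= n * g i.+1 X.
Proof.
move=> cutP ik; have [<- _ _] := cutP i ik; have lt := chain_stepX C ik.
by rewrite /cut !mulnDl leq_add2l leq_add2r !leq_mul2l (ltnW lt) !orbT.
Qed.

(** The cuts split the minimal n-fold sums into k + 1 windows, the i-th one
    around n g_i.  Translating it by g_i gives the same count for n + 1, and
    the translates of windows i and i + 1 leave between them a gap of length
    g_(i+1) - g_i.  So mu grows by the numbers of minimal sums in the gaps. *)
Lemma first_difference n al be : cuts n al be ->
  #|` G n.+1| = #|` G n| +
    \sum_(i < k) window_count n.+1 (cut al be i + g i X) (cut al be i + g i.+1 X).
Proof.
move=> cutP; have k0 := chain_gt0 C.
pose lo i := if i is j.+1 then cut al be j else n * g 0 X.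
pose hi i := if i < k then cut al be i else (n * g k X).+1.
have lo_hi i : i <= k -> lo i <= hi i.
  move=> ik; apply: (@leq_trans (n * g i X)).
    by case: i ik => [|i] ik //=; have /andP[] := cut_range cutP ik.
  rewrite /hi; case: ltnP => [ltik|ki]; first by have /andP[] := cut_range cutP ltik.
  by have -> : i = k by lia.
have shift i : i <= k -> window_count n.+1 (lo i + g i X) (hi i + g i X) = window_count n (lo i) (hi i).
  move=> ik; have [v [min_v vX min_vg]] : exists v,
      [/\ minsum A n v, v X = lo i & minsum A n.+1 (v + g i)%MM].
    case: i ik => [|i] ik.
      exists (edge_sum 0 n 0); rewrite edge_sumE edge_sumDl addn0; split=> //.
        by rewrite -{1}[n]addn0; apply: minsum_edge.
      by rewrite -{1}[n.+1]addn0; apply: minsum_edge.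
    have [En _ _] := cutP i ik.
    exists (edge_sum i (al i) (be i)); rewrite edge_sumE edge_sumDr; split=> //.
      by rewrite -En; apply: minsum_edge.
    by rewrite -En -addnS; apply: minsum_edge.
  apply: window_shift min_v vX min_vg _ => // u uG /andP[lo_u u_hi].
  apply: divisible_in_window => // [ltik|i0].
    by apply: (cut_right cutP) => //; move: u_hi; rewrite /hi ltik.
  by case: i ik lo_u i0 {u_hi} => // i ik lo_u _; apply: (cut_left cutP).
have start m : count_left m (m * g 0 X) = 0.
  apply/eqP; rewrite eqn0Ngt -has_count; apply/hasPn => u /G_range/andP[le_u _].
  by rewrite -leqNgt.
have stop m : count_left m (m * g k X).+1 = #|` G m|.
  by apply/eqP; rewrite -all_count; apply/allP => u /G_range/andP[].
(* Sweeping from left to right: up to the end of the translated window i, the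
   counts for n and n + 1 differ by the gaps passed. *)
have partial i : i <= k -> count_left n.+1 (hi i + g i X) = count_left n (hi i) +
    \sum_(j < i) window_count n.+1 (cut al be j + g j X) (cut al be j + g j.+1 X).
  elim: i => [|i IHi] ik.
    rewrite big_ord0 addn0 (count_leftD _ (lo_hi 0 isT)) -shift //= start.
    rewrite (@count_leftD _ (n * g 0 X + g 0 X)) ?leq_add2r ?(lo_hi 0) //.
    by rewrite [n * _ + _]addnC -mulSn start.
  have lt_i : g i X < g i.+1 X := chain_stepX C ik.
  have hi_i : hi i = cut al be i by rewrite /hi ik.
  rewrite big_ord_recr /= addnA addnAC (count_leftD _ (lo_hi _ ik)) -shift //=.
  rewrite (@count_leftD _ (cut al be i + g i.+1 X)) ?leq_add2r ?(lo_hi i.+1) //.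
  rewrite (@count_leftD _ (cut al be i + g i X) (_ + g i.+1 X)) ?leq_add2l ?(ltnW lt_i) //.
  rewrite -{1}hi_i (IHi (ltnW ik)) hi_i.
  by rewrite -!addnA; congr (_ + _); rewrite addnC -addnA [RHS]addnCA; congr (_ + _); rewrite addnC.
have := partial k (leqnn k); rewrite /hi ltnn stop => <-.
by rewrite -stop mulSn addSn addnC.
Qed.

(** With the cuts moved by g_i, the i-th gap for n + 2 is the translate by g_i
    of the i-th gap for n + 1, because it lies where minimal sums have g_i as a
    summand. *)
Lemma difference_shift n al be i : cuts n al be -> i < k ->
  window_count n.+2 (cut al be i + g i X + g i X) (cut al be i + g i X + g i.+1 X) =
  window_count n.+1 (cut al be i + g i X) (cut al be i + g i.+1 X).
Proof.
move=> cutP ik; have [En hal hbe] := cutP i ik.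
rewrite addnAC -[RHS](@window_shift _ i _ _ (edge_sum i (al i).+1 (be i))) ?(ltnW ik) //.
- by rewrite -En -addSn; apply: minsum_edge.
- by rewrite edge_sumE /cut mulSn; lia.
- by rewrite edge_sumDl -En -!addSn; apply: minsum_edge.
move=> u uG /andP[lo_u u_hi]; apply: divisible_in_window (ltnW ik) uG _ _ => [_|i0].
  (* The gap for n + 2 ends at the cut with one more g_(i+1), translated by
     g_i, so the right-hand bound is the one for that cut. *)
  have cutP' : cuts n.+1 al (fun j => (be j).+1).
    by move=> j jk; have [E1 E2 E3] := cutP j jk; split=> //; nia.
  by apply: (cut_right cutP') => //; move: u_hi; rewrite /cut mulSn; lia.
have i1k : i.-1 < k by lia.
have := chain_stepX C i1k; rewrite prednK // => lt_i.
have lt_k := chain_leX C (ltnW ik) (leqnn k).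
have lt_w := chain_stepX C ik; have le0 := chain_leX C (leq0n i) (ltnW ik).
have le_n : D <= n.+2.
  suff : D <= al i by lia.
  rewrite -(@leq_pmul2r (g i.+1 X - g i X)) ?subn_gt0 //; apply: leq_trans hal.
  by rewrite leq_mul2l; lia.
have [c Ec] : exists c, g k X = g i X + c by exists (g k X - g i X); lia.
have [w Ew] : exists w, g i.+1 X = g i X + w by exists (g i.+1 X - g i X); lia.
have [e Ee] : exists e, g i X = g i.-1 X + e by exists (g i X - g i.-1 X); lia.
have [m Em] : exists m, n.+2 = D + m by exists (n.+2 - D); lia.
move: hbe lo_u; have -> : g k X - g i X = c by lia.
have -> : g i.+1 X - g i X = w by lia.
move=> hbe lo_u; have {}lo_u : n.+2 * g i X + be i * w <= u X.
  by apply: leq_trans lo_u; rewrite /cut -En Ew; lia.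
have : n.+2 * g i.-1 X + D * g k X < n.+2 * g i X + be i * w + D * g i.-1 X.
  by rewrite Em Ec Ee; nia.
by move/leq_trans; apply; rewrite leq_add2r.
Qed.

(** With x_j the X-coordinate of g_j and w the width of edge i, take be minimal
    with D (x_k - x_i) < be w and al = n - be.  As r w >= D (x_k - x_0) and
    n >= D + r + 1, what remains satisfies
    al w >= D w + D (x_k - x_0) - D (x_k - x_i) = D (x_(i+1) - x_0). *)
Lemma exists_cuts n r : D + r + 1 <= n ->
  (forall i, i < k -> D * (g k X - g 0 X) <= r * (g i.+1 X - g i X)) ->
  exists al be, cuts n al be.
Proof.
move=> le_n le_r; pose be i := (D * (g k X - g i X) %/ (g i.+1 X - g i X)).+1.
exists (fun i => n - be i), be => i ik; have := le_r i ik.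
have lt_w := chain_stepX C ik; have le0 := chain_leX C (leq0n i) (ltnW ik).
have lt_k : g i.+1 X <= g k X := chain_leX C ik (leqnn k).
have [c Ec] : exists c, g k X = g i.+1 X + c by exists (g k X - g i.+1 X); lia.
have [w Ew] : exists w, g i.+1 X = g i X + w by exists (g i.+1 X - g i X); lia.
have [b Eb] : exists b, g i X = g 0 X + b by exists (g i X - g 0 X); lia.
rewrite /be; have -> : g k X - g i X = w + c by lia.
have -> : g k X - g 0 X = b + w + c by lia.
have -> : g i.+1 X - g i X = w by lia.
have -> : g i.+1 X - g 0 X = b + w by lia.
have w0 : 0 < w by lia.
move=> le_rw; have := leq_trunc_div (D * (w + c)) w; have := ltn_ceil (D * (w + c)) w0.
set q := _ %/ w => lt_q le_q; have le_qr : q <= D + r.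
  rewrite -(leq_pmul2r w0); nia.
split=> //; first by lia.
have : D + r - q <= n - q.+1 by lia.
rewrite -(leq_pmul2r w0); apply: leq_trans.
rewrite mulnBl mulnDl; nia.
Qed.

Theorem second_difference n r : D + r + 1 <= n ->
  (forall i, i < k -> D * (g k X - g 0 X) <= r * (g i.+1 X - g i X)) ->
  #|` G n.+2| + #|` G n| = 2 * #|` G n.+1|.
Proof.
move=> le_n /(exists_cuts le_n)[al [be cutP]].
rewrite (first_difference (cuts_succ cutP)).
have -> : \sum_(i < k) window_count n.+2 (cut (fun i => (al i).+1) be i + g i X)
                               (cut (fun i => (al i).+1) be i + g i.+1 X) =
          \sum_(i < k) window_count n.+1 (cut al be i + g i X) (cut al be i + g i.+1 X).
  apply: eq_bigr => i _; rewrite -(difference_shift cutP) //.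
  suff : cut (fun i => (al i).+1) be i = cut al be i + g i X by move=> ->.
  by rewrite /cut mulSn; lia.
by rewrite (first_difference cutP); lia.
Qed.

End Counting.

(** * Persistent generators and the Newton polygon *)

(** Persistence, in terms of exponent vectors: some power of the monomial f lies
    in the corresponding power of the ideal generated by p and q exactly when
    some n f with n > 0 dominates a combination of p and q with coefficients of
    sum n. *)
Definition vertex (A : {fset mon}) (f : mon) : Prop :=
  f \in A /\ forall p q, (exists2 a, a \in A & (a <= p)%MM) -> p <> f ->
    (exists2 a, a \in A & (a <= q)%MM) -> q <> f ->
    forall a b, 0 < a + b -> ~ (msum (nseq a p ++ nseq b q) <= f *+ (a + b))%MM.

(** Weak persistence of a generator: the n-th power of the monomial f is a
    minimal generator of I^n exactly when n f is a minimal n-fold sum. *)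
Definition stable (A : {fset mon}) (f : mon) : Prop :=
  forall n, 0 < n -> minsum A n (f *+ n)%MM.

Lemma argmin (F : mon -> nat) (s : seq mon) : s != [::] ->
  exists2 f, f \in s & forall a, a \in s -> F f <= F a.
Proof.
elim: s => // a s IHs _; have [->|/IHs[f fs minf]] := eqVneq s [::].
  by exists a; rewrite ?mem_head // => b; rewrite inE => /eqP->.
have [le|lt] := leqP (F a) (F f).
  exists a; rewrite ?mem_head // => b; rewrite inE => /predU1P[-> //|/minf].
  exact: leq_trans.
by exists f; rewrite ?inE ?fs ?orbT // => b; rewrite inE => /predU1P[->|/minf //]; lia.
Qed.

(** Among the minimizers on A of the form c X + d Y take the one with smallest
    X.  If a multiple of it dominated a combination of other elements of the
    ideal, those that occur in it would have to be minimizers as well, with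
    strictly larger X, contradicting the domination in X. *)
Lemma exists_vertex (X Y : 'I_2) (A : {fset mon}) c d : X != Y -> 0 < d ->
  (exists a, a \in A) -> exists2 f, vertex A f &
    forall a, a \in A -> c * f X + d * f Y <= c * a X + d * a Y.
Proof.
move=> XY d0 [a0 a0A]; pose L (u : mon) := c * u X + d * u Y.
have [|f0 f0A minf0] := @argmin L (enum_fset A).
  by apply/eqP => E; have : a0 \in enum_fset A := a0A; rewrite E.
pose s := [seq a <- A | L a == L f0].
have [|f] := @argmin (fun u => u X) s.
  apply/eqP => E; have : f0 \in s by rewrite mem_filter eqxx.
  by rewrite E.
rewrite mem_filter => /andP[/eqP Lf fA] minf.
exists f => [|a aA]; last by rewrite -/(L f) Lf minf0.
have strict p : (exists2 a, a \in A & (a <= p)%MM) -> p <> f ->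
    L f <= L p /\ (L p = L f -> f X < p X).
  move=> [a aA]; rewrite (mon_leE _ _ XY) => /andP[leX leY] neq_pf.
  have Lap : L a <= L p by rewrite leq_add // leq_mul2l ?leX ?leY orbT.
  have Laf : L f <= L a by rewrite Lf minf0.
  split=> [|Lpf]; first exact: leq_trans Lap.
  have fa : f X <= a X by apply: minf; rewrite mem_filter aA andbT; apply/eqP; lia.
  rewrite ltn_neqAle (leq_trans fa leX) andbT; apply/eqP => E; apply: neq_pf.
  apply: (mon_eq XY) => //; apply/eqP; rewrite -(eqn_pmul2l d0); apply/eqP.
  by move: Lpf; rewrite /L -E; lia.
split=> // p q /strict sp /sp[Lp Xp] /strict sq /sq[Lq Xq] m n mn0.
rewrite (mon_leE _ _ XY) msum_cat !mnmDE !msum_nseq !mulmnE => /andP[leX leY].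
have E : m * L p + n * L q <= (m + n) * L f by rewrite /L; nia.
have Em : m * (L p - L f) = 0 by nia.
have En : n * (L q - L f) = 0 by nia.
have [m0|m0] := posnP m.
  have n0 : 0 < n by lia.
  have /Xq : L q = L f by nia.
  by move: leX; rewrite m0; nia.
have /Xp : L p = L f by nia.
have [n0|n0] := posnP n; first by move: leX; rewrite n0; nia.
have /Xq : L q = L f by nia.
by nia.
Qed.

(** If q were strictly above the chord p r, then (r_X - p_X) q would dominate
    the different combination of p and r with the same X-coordinate, and so
    would not be a minimal sum. *)
Lemma stable_below_chord (X Y : 'I_2) (A : {fset mon}) p q r : X != Y ->
  stable A q -> p \in A -> r \in A -> p X < q X -> q X < r X ->
  (r X - p X) * q Y <= (r X - q X) * p Y + (q X - p X) * r Y.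
Proof.
move=> XY st_q pA rA pq qr; rewrite leqNgt; apply/negP => lt.
have N0 : 0 < r X - p X by lia.
have [_ min_q] := st_q _ N0.
pose z := msum (nseq (r X - q X) p ++ nseq (q X - p X) r).
have zE Z : z Z = (r X - q X) * p Z + (q X - p X) * r Z.
  by rewrite /z msum_cat mnmDE !msum_nseq.
have zX : z X = q X * (r X - p X) by rewrite zE; nia.
have Sz : sumset A (r X - p X) z.
  have -> : r X - p X = (r X - q X) + (q X - p X) by lia.
  by rewrite /z msum_cat; apply: sumsetD; apply: sumset_nseq.
have le_z : (z <= q *+ (r X - p X))%MM.
  by rewrite (mon_leE _ _ XY) !mulmnE zX leqnn zE /= [leqRHS]mulnC ltnW.
move/(congr1 (fun u : mon => u Y)): (min_q _ Sz le_z).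
by rewrite zE mulmnE; lia.
Qed.

(** Otherwise a minimizer f of the linear form of the edge would lie strictly
    under its line.  It can be taken to be a vertex, hence some g_m with m < i
    or m > i + 1.  Then g_i, respectively g_(i+1), is strictly above the chord
    from g_m to the other end of the edge, against its stability. *)
Lemma above_edge_line (X Y : 'I_2) (A : {fset mon}) (g : nat -> mon) k i a :
  X != Y ->
  (forall j, j <= k -> g j \in A /\ stable A (g j)) ->
  (forall f, vertex A f -> exists2 j, j <= k & f = g j) ->
  (forall j l, j < l -> l <= k -> g j X < g l X) ->
  i < k -> g i.+1 Y < g i Y -> a \in A ->
  (g i Y - g i.+1 Y) * g i X + (g i.+1 X - g i X) * g i Y <=
  (g i Y - g i.+1 Y) * a X + (g i.+1 X - g i X) * a Y.
Proof.
move=> XY gA vert ltX ik ltYi aA; rewrite leqNgt; apply/negP => lt.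
have ltXi := ltX _ _ (ltnSn i) ik.
have w0 : 0 < g i.+1 X - g i X by lia.
have [f fv fmin] :=
  exists_vertex (g i Y - g i.+1 Y) XY w0 (ex_intro (fun b => b \in A) a aA).
have {fmin aA}lt := leq_ltn_trans (fmin a aA) lt.
have [m mk Em] := vert _ fv; have fA := fv.1; rewrite {f fv}Em in lt fA.
have [mi|im|Emi] := ltngtP m i; last by rewrite Emi ltnn in lt.
  have ltXm := ltX _ _ mi (ltnW ik).
  have := stable_below_chord XY (gA _ (ltnW ik)).2 fA (gA _ ik).1 ltXm ltXi.
  by move: lt {gA vert ltX XY}; nia.
have [im1|mi1|Emi] := ltngtP i.+1 m; last first.
- by move: lt {gA vert ltX XY}; rewrite -Emi; nia.
- by lia.
have ltXm := ltX _ _ im1 mk.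
have := stable_below_chord XY (gA _ ik).2 (gA _ (ltnW ik)).1 fA ltXi ltXm.
by move: lt {gA vert ltX XY}; nia.
Qed.

Lemma boundary_chain_vertices (X Y : 'I_2) (A : {fset mon}) (g : nat -> mon) k :
  X != Y ->
  (forall a b, a \in A -> b \in A -> (a <= b)%MM -> a = b) ->
  (exists a b, [/\ a \in A, b \in A & a <> b]) ->
  (forall i, i <= k -> g i \in A /\ stable A (g i)) ->
  (forall f, vertex A f -> exists2 i, i <= k & f = g i) ->
  (forall i, i < k -> g i.+1 Y <= g i Y /\ g i.+1 != g i) ->
  boundary_chain X Y A g k.
Proof.
move=> XY anti [a1 [a2 [a1A a2A neq12]]] gA vert step.
have nonempty : exists a, a \in A by exists a1.
have antiX a b : a \in A -> b \in A -> a Y <= b Y -> b X <= a X.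
  move=> aA bA le; rewrite leqNgt; apply/negP => lt.
  have E : a = b by apply: anti => //; rewrite (mon_leE _ _ XY) le ltnW.
  by rewrite E ltnn in lt.
have stepX i : i < k -> g i X < g i.+1 X.
  move=> ik; have [le neq] := step i ik.
  have [gi gi1] : g i \in A /\ g i.+1 \in A by split; apply: (gA _ _).1; lia.
  rewrite ltnNge; apply: contraNN neq => leX; apply/eqP/anti => //.
  by rewrite (mon_leE _ _ XY) leX.
have stepY i : i < k -> g i.+1 Y < g i Y.
  move=> ik; have [le neq] := step i ik.
  have [gi gi1] : g i \in A /\ g i.+1 \in A by split; apply: (gA _ _).1; lia.
  rewrite ltnNge; apply: contraNN neq => leY; apply/eqP/esym/anti => //.
  by rewrite (mon_leE _ _ XY) leY ltnW ?stepX.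
have ltX := step_trans (F := fun j => g j X) ltn_trans stepX.
have leX i l : i <= l -> l <= k -> g i X <= g l X.
  by rewrite leq_eqVlt => /predU1P[-> // | il lk]; apply/ltnW/ltX.
(* The leftmost and the lowest element of A are vertices, hence points of the
   chain; they are different because A is an antichain with two elements. *)
have YX : Y != X by rewrite eq_sym.
have [fl fl_v fl_min] := exists_vertex 0 YX (isT : 0 < 1) nonempty.
have [fr fr_v fr_min] := exists_vertex 0 XY (isT : 0 < 1) nonempty.
have flX a : a \in A -> fl X <= a X by move/fl_min; rewrite !mul0n !mul1n.
have frY a : a \in A -> fr Y <= a Y by move/fr_min; rewrite !mul0n !mul1n.
have [i ik Ei] := vert _ fl_v; have [j jk Ej] := vert _ fr_v.
split=> //.
- rewrite lt0n; apply/eqP => k0; apply: neq12.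
  have Elr : fl = fr by rewrite Ei Ej; have -> : i = j by lia.
  have low a : a \in A -> fl = a.
    by move=> aA; apply: (anti _ _ fl_v.1 aA); rewrite (mon_leE _ _ XY) flX // Elr frY.
  by rewrite -(low _ a1A) -(low _ a2A).
- by move=> l /gA[].
- move=> a aA; apply/andP; split.
    by apply: leq_trans (flX _ aA); rewrite Ei leX.
  apply: leq_trans (_ : fr X <= _); last by rewrite Ej leX.
  by apply: (antiX _ _ fr_v.1 aA); apply: frY.
by move=> l a lk aA; apply: (above_edge_line XY gA vert ltX lk (stepY l lk) aA).
Qed.

Definition chain_points (P : {fset mon}) : seq mon :=
  sort (fun g h : mon => h iy <= g iy) P.

Local Open Scope ring_scope.

(** * Monomial ideals and their minimal generators *)

Section IdealGen.
Variable R : comNzRingType.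
Implicit Types A B : R -> Prop.

Lemma ideal_gen0 A : ideal_gen A 0.
Proof. by exists [::]; split=> //; rewrite big_nil. Qed.

Lemma ideal_genD A p q : ideal_gen A p -> ideal_gen A q -> ideal_gen A (p + q).
Proof.
move=> [s [sA ->]] [t [tA ->]]; exists (s ++ t); rewrite big_cat; split=> // u.
by rewrite mem_cat => /orP[/sA|/tA].
Qed.

Lemma ideal_genM A p q : ideal_gen A q -> ideal_gen A (p * q).
Proof.
move=> [s [sA ->]]; exists [seq (p * u.1, u.2) | u <- s]; split=> [u /mapP[v vs ->]|].
  exact: (sA v vs).
by rewrite big_map mulr_sumr; apply: eq_bigr => u _; rewrite mulrA.
Qed.

Lemma ideal_gen_mem A p : A p -> ideal_gen A p.
Proof.
move=> Ap; exists [:: (1, p)]; rewrite big_seq1 mul1r; split=> // u.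
by rewrite inE => /eqP->.
Qed.

Lemma ideal_gen_sum A (T : eqType) (s : seq T) (F : T -> R) :
  (forall x, x \in s -> ideal_gen A (F x)) -> ideal_gen A (\sum_(x <- s) F x).
Proof.
elim: s => [|x s IHs] H; first by rewrite big_nil; apply: ideal_gen0.
rewrite big_cons; apply: ideal_genD; first by apply: H; rewrite mem_head.
by apply: IHs => y ys; apply: H; rewrite inE ys orbT.
Qed.

Lemma ideal_gen_sub A B : (forall p, A p -> ideal_gen B p) ->
  forall p, ideal_gen A p -> ideal_gen B p.
Proof.
move=> AB p [s [sA ->]]; apply: ideal_gen_sum => u us.
exact/ideal_genM/AB/sA.
Qed.

End IdealGen.

Section MonIdeal.
Variable k : fieldType.
Implicit Types (M N : mon -> Prop) (I J : {mpoly k[2]} -> Prop).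

Lemma mem_mon_ideal M (p : {mpoly k[2]}) : mon_ideal M p <->
  forall m, m \in msupp p -> exists2 m', M m' & (m' <= m)%MM.
Proof.
split=> [[s [sM ->]] m|H].
  move/msupp_sum_le/flattenP => [t /mapP[u us ->]].
  have {us}us : u \in s by move: us; rewrite filter_predT.
  have [m' Mm' ->] := sM u us.
  rewrite (perm_mem (msuppMX _ _)) => /mapP[c _ ->]; exists m' => //.
  exact: lem_addr.
rewrite [p]mpolyE; apply: ideal_gen_sum => m /H[m' Mm' le_m].
rewrite -(submK le_m) mpolyXD -mul_mpolyC.
apply/ideal_genM/ideal_genM/ideal_gen_mem; by exists m'.
Qed.

Lemma mon_idealX M m : mon_ideal M ('X_[m] : {mpoly k[2]}) <-> exists2 m', M m' & (m' <= m)%MM.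
Proof.
rewrite mem_mon_ideal msuppX; split=> [|H u]; first by apply; rewrite inE.
by rewrite inE => /eqP->.
Qed.

Lemma monomial_mem I p : monomial_ideal I ->
  I p <-> forall m, m \in msupp p -> I 'X_[m].
Proof.
move=> [M IM]; rewrite (IM p) mem_mon_ideal.
by split=> H m /H; rewrite (IM _) mon_idealX.
Qed.

Lemma monomial_idealP I : (forall p, I p <-> forall m, m \in msupp p -> I 'X_[m]) ->
  (forall m m', I 'X_[m] -> (m <= m')%MM -> I 'X_[m']) -> monomial_ideal I.
Proof.
move=> Isupp Iup; exists (fun m => I 'X_[m]) => p; rewrite Isupp mem_mon_ideal.
split=> H m /H; first by exists m => //; apply: lepm_refl.
by case=> m' /Iup; apply.
Qed.

Lemma monomial_up I m m' : monomial_ideal I -> I 'X_[m] -> (m <= m')%MM -> I 'X_[m'].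
Proof.
move=> [M IM]; rewrite !(IM _) !mon_idealX => -[u Mu um] mm'.
by exists u => //; apply: lepm_trans mm'.
Qed.

Lemma same_monomial I J : monomial_ideal I -> monomial_ideal J ->
  (forall m, I 'X_[m] <-> J 'X_[m]) -> same_ideal I J.
Proof.
move=> mI mJ IJ p; rewrite (monomial_mem _ mI) (monomial_mem _ mJ).
by split=> H m /H /IJ.
Qed.

Lemma monomial_mon_ideal M : monomial_ideal (mon_ideal (k := k) M).
Proof. by exists M => p. Qed.

Definition minimal_in I : mon -> Prop := minimal (fun u => I 'X_[u]).

Lemma minimal_in_below I m :
  I 'X_[m] -> exists2 m', minimal_in I m' & (m' <= m)%MM.
Proof. exact: (minimal_below (S := fun u => I 'X_[u])). Qed.

(** Dickson's lemma in two variables.  Fix a minimal m0: every minimal m has some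
    coordinate at most that of m0, since otherwise m0 would be below m.  Minimal
    vectors that agree in one coordinate are comparable, hence equal, so for
    each direction and each value of the coordinate there is one candidate. *)
Lemma minimal_finite I : exists G : {fset mon}, forall m, m \in G <-> minimal_in I m.
Proof.
have [[m0 [Im0 _]]|no] := classic (exists m, minimal_in I m); last first.
  by exists fset0 => m; split=> [|H]; [rewrite inE|case: no; exists m].
pose cand i n := epsilon (inhabits 0%MM) (fun m : mon => minimal_in I m /\ m i = n).
pose s := [seq cand i n | i <- enum 'I_2, n <- iota 0 (mdeg m0).+1].
have sP m : minimal_in I m -> m \in s.
  move=> min_m; have [i le_i] : exists i, (m i <= m0 i)%N.
    apply: NNPP => no; have le : (m0 <= m)%MM.
      by apply/mnm_lepP => i; rewrite leqNgt; apply/negP => lt; apply: no; exists i; apply: ltnW.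
    by apply: no; exists ix; have [_ min_m'] := min_m; rewrite (min_m' m0 Im0 le).
  apply/allpairsP; exists (i, m i); rewrite mem_enum mem_iota /=; split=> //.
    rewrite ltnS; apply: leq_trans le_i _; rewrite mdegE (bigD1 i) //=; exact: leq_addr.
  have [min_c eq_c] : minimal_in I (cand i (m i)) /\ cand i (m i) i = m i.
    exact: (epsilon_spec _ (fun u : mon => _ /\ u i = m i) (ex_intro _ m (conj min_m erefl))).
  have [j ij] : exists j, i != j by case: (eqVneq i ix) => [->|]; [exists iy|exists ix].
  have [le|lt] := leqP (m j) (cand i (m i) j).
    by apply: (proj2 min_c); [exact: (proj1 min_m)|rewrite (mon_leE _ _ ij) eq_c leqnn].
  apply/esym/(proj2 min_m); first exact: (proj1 min_c).
  by rewrite (mon_leE _ _ ij) eq_c leqnn ltnW.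
pose b m : bool := excluded_middle_informative (minimal_in I m).
have bP m : reflect (minimal_in I m) (b m).
  by rewrite /b; case: excluded_middle_informative => H; constructor.
exists (seq_fset tt [seq m <- s | b m]) => m; rewrite seq_fsetE mem_filter.
by split=> [/andP[/bP]//|H]; apply/andP; split; [apply/bP|apply: sP].
Qed.

(** By minimality of the generating set, an element with a proper divisor in I
    could be discarded; conversely a minimal monomial of I is divisible only by
    itself among the generators. *)
Lemma mingensP I m : monomial_ideal I -> m \in mingens I <-> minimal_in I m.
Proof.
move=> mI; have gen_iff (G : {fset mon}) :
    same_ideal I (mon_ideal (fun m => m \in G)) <->
    (forall m : mon, I 'X_[m] <-> exists2 m', m' \in G & (m' <= m)%MM).
  split=> [IG u|H]; first by rewrite (IG _) mon_idealX.
  apply: same_monomial => // [|u]; first exact: monomial_mon_ideal.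
  by rewrite mon_idealX.
have [G GP] := minimal_finite I.
have [gen_H min_H] : is_min_mon_gens I (mingens I).
  apply: (epsilon_spec _ (is_min_mon_gens I)); exists G; split.
    apply/gen_iff => u; split=> [/minimal_in_below[v /GP]|[v /GP[Iv _]]]; first by exists v.
    exact: monomial_up.
  move=> H HG /gen_iff gen_H; apply/eqP; rewrite eqEfsubset HG /=.
  apply/fsubsetP => u /GP[/gen_H[v vH le_v] min_u].
  by rewrite -(min_u v) //; apply/gen_H; exists v => //; apply: lepm_refl.
have {}gen_H := proj1 (gen_iff _) gen_H.
split=> [mH|[/gen_H[v vH le_v] min_m]]; last first.
  by rewrite -(min_m v) //; apply/gen_H; exists v => //; apply: lepm_refl.
have Im : I 'X_[m] by apply/gen_H; exists m => //; apply: lepm_refl.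
split=> // m' Im' le_m'; have [v vH le_v] := proj1 (gen_H m') Im'.
have le_vm := lepm_trans le_v le_m'.
have [E|neq] := eqVneq v m; first 
  by apply: mon_anti => //; rewrite -E.
have E : (mingens I `\ m = mingens I)%fset.
  apply: min_H; first exact: fsubsetDl.
  apply/gen_iff => u; rewrite gen_H; split=> [[w wH le_w]|[w]]; last first.
    by rewrite in_fsetD1 => /andP[_ wH] le_w; exists w.
  have [Ew|neq_w] := eqVneq w m; last by exists w; rewrite // in_fsetD1 neq_w.
  by exists v; [rewrite in_fsetD1 neq|apply: lepm_trans le_vm _; rewrite -Ew].
by move: mH; rewrite -E in_fsetD1 eqxx.
Qed.
Lemma mingens_gen I : monomial_ideal I ->
  same_ideal I (mon_ideal (fun m => m \in mingens I)).
Proof.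
move=> mI; apply: same_monomial => // [|m]; first exact: monomial_mon_ideal.
rewrite mon_idealX; split=> [/minimal_in_below[u min_u le_u]|[u]].
  by exists u => //; apply/mingensP.
by move/mingensP => /(_ mI)[Iu _]; apply: monomial_up.
Qed.

Lemma mem_monomial I m : monomial_ideal I ->
  I 'X_[m] <-> exists2 a, a \in mingens I & (a <= m)%MM.
Proof. by move=> mI; rewrite (mingens_gen mI _) mon_idealX. Qed.

(** Stated for an arbitrary finite generating set, since it serves both for I and
    for the ideals generated by two monomials in the integral closure. *)
Lemma pow_mon_ideal I (A : {fset mon}) n :
  same_ideal I (mon_ideal (fun m => m \in A)) ->
  same_ideal (ideal_pow I n) (mon_ideal (sumset A n)).
Proof.
move=> IA; elim: n => [|n IHn] p.
  split=> // _; apply/mem_mon_ideal => m _; exists 0%MM; last first.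
    by apply/mnm_lepP=> i; rewrite mnm0E.
  by exists [::]; split; rewrite // /msum big_nil.
rewrite /ideal_pow iterS -/(ideal_pow I n); split; apply: ideal_gen_sub => q.
  move=> [a [b [/IA/mem_mon_ideal aA /IHn/mem_mon_ideal bS ->]]].
  apply/mem_mon_ideal => m /msuppM_le/allpairsP[[m1 m2] /= [/aA[c cA le_c] /bS[d dS le_d] ->]].
  exists (c + d)%MM; first by rewrite -add1n; apply: sumsetD => //; apply: sumset1.
  by apply/mnm_lepP=> i; rewrite !mnmDE leq_add // (mnm_lepP _ _).
move=> [_ [s [sA sz_s ->]] ->]; case: s sA sz_s => // a s sA [sz_s].
apply: ideal_gen_mem.
exists 'X_[a], 'X_[msum s]; split.
- apply/IA/mon_idealX; exists a; [apply: sA; exact: mem_head|exact: lepm_refl].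
- apply/IHn/mon_idealX; exists (msum s); last exact: lepm_refl.
  by exists s; split=> // b bs; apply: sA; rewrite inE bs orbT.
by rewrite msum_cons mpolyXD.
Qed.

Lemma mem_pow I m n : monomial_ideal I ->
  ideal_pow I n 'X_[m] <-> exists2 z, sumset (mingens I) n z & (z <= m)%MM.
Proof. by move=> mI; rewrite (pow_mon_ideal n (mingens_gen mI) _) mon_idealX. Qed.

Lemma monomial_pow I n : monomial_ideal I -> monomial_ideal (ideal_pow I n).
Proof. by move=> mI; exists (sumset (mingens I) n); apply/pow_mon_ideal/mingens_gen. Qed.

Lemma mingens_pow I n u : monomial_ideal I ->
  u \in mingens (ideal_pow I n) <-> minsum (mingens I) n u.
Proof.
move=> mI; rewrite (mingensP _ (monomial_pow n mI)).
split=> [[/(mem_pow _ _ mI)[z Sz le_z] min_u]|[Su min_u]].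
  have Ez : z = u.
    by apply: min_u => //; apply/mem_pow => //; exists z => //; apply: lepm_refl.
  split=> [|w Sw le_w]; first by rewrite -Ez.
  by apply: min_u => //; apply/mem_pow => //; exists w => //; apply: lepm_refl.
split=> [|w /(mem_pow _ _ mI)[z Sz le_z] le_w].
  by apply/mem_pow => //; exists u => //; apply: lepm_refl.
have Ez := min_u z Sz (lepm_trans le_z le_w).
by apply: mon_anti => //; rewrite -Ez.
Qed.

Lemma mingens_anti I a b : monomial_ideal I ->
  a \in mingens I -> b \in mingens I -> (a <= b)%MM -> a = b.
Proof.
by move=> mI /(mingensP _ mI)[Ia _] /(mingensP _ mI)[_ min_b]; apply: min_b.
Qed.

Lemma nonprincipal_two I : monomial_ideal I -> ~ principal I ->
  exists a b, [/\ a \in mingens I, b \in mingens I & a <> b].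
Proof.
move=> mI nprI; apply: NNPP => no; apply: nprI.
have [[a aA]|empty] := classic (exists a, a \in mingens I).
  have single b : b \in mingens I -> b = a.
    by move=> bA; apply: NNPP => neq; apply: no; exists b, a.
  exists 'X_[a] => p; rewrite (mingens_gen mI _); split; apply: ideal_gen_sub => q.
    by move=> [m /single-> ->]; apply: ideal_gen_mem.
  by move=> ->; apply: ideal_gen_mem; exists a.
exists 0 => p; rewrite (mingens_gen mI _); split; apply: ideal_gen_sub => q.
  by move=> [m mA _]; case: empty; exists m.
by move=> ->; apply: ideal_gen0.
Qed.

Lemma gcd_monE I (lo : 'I_2 -> nat) i : monomial_ideal I ->
  (forall i a, a \in mingens I -> (lo i <= a i)%N) ->
  (forall i, exists2 a, a \in mingens I & a i = lo i) ->
  gcd_mon I i = lo i.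
Proof.
move=> mI lo_le lo_eq; pose e : mon := [multinom lo i | i < 2].
have le_e (m : mon) : I 'X_[m] -> (e <= m)%MM.
  move=> /(mem_monomial m mI)[a aA le_a]; apply: lepm_trans le_a.
  by apply/mnm_lepP => j; rewrite mnmE lo_le.
have gen_in a : a \in mingens I -> I 'X_[a] by case/mingensP.
have [gcd_le gcd_max] : is_gcd_mon I (gcd_mon I).
  apply: (epsilon_spec _ (is_gcd_mon I)); exists e; split=> // d le_d.
  apply/mnm_lepP => j; rewrite mnmE; have [a aA <-] := lo_eq j.
  exact: (mnm_lepP (le_d _ (gen_in _ aA))).
apply/eqP; rewrite eqn_leq; apply/andP; split.
  by have [a aA <-] := lo_eq i; apply: (mnm_lepP (gcd_le _ (gen_in _ aA))).
by move/mnm_lepP/(_ i): (gcd_max e le_e); rewrite mnmE.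
Qed.

(** Dividing by the gcd translates the minimal generators so that their smallest
    coordinates become 0; the largest ones are then the extents. *)
Lemma distE I (lo hi : 'I_2 -> nat) i : monomial_ideal I ->
  (forall i a, a \in mingens I -> (lo i <= a i <= hi i)%N) ->
  (forall i, exists2 a, a \in mingens I & a i = lo i) ->
  (forall i, exists2 a, a \in mingens I & a i = hi i) ->
  dist i I = (hi i - lo i)%N.
Proof.
move=> mI lo_hi lo_eq hi_eq.
have lo_le j a : a \in mingens I -> (lo j <= a j)%N by move/(lo_hi j)/andP=> [].
have dE j : gcd_mon I j = lo j by exact: (gcd_monE j mI lo_le lo_eq).
set d := gcd_mon I; pose J := ideal_colon I 'X_[d].
have JX (m : mon) : J 'X_[m] <-> I 'X_[m + d] by rewrite /J /ideal_colon mpolyXD.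
have mJ : monomial_ideal J.
  apply: monomial_idealP => [p|m m' /JX Im le_m]; last first.
    by apply/JX/(monomial_up mI Im)/mnm_lepP => j; rewrite !mnmDE leq_add2r (mnm_lepP le_m).
  rewrite /J /ideal_colon (monomial_mem _ mI); split=> H m.
    move=> mp; rewrite -mpolyXD; apply: H; rewrite (perm_mem (msuppMX _ _)).
    by rewrite addmC; apply: map_f.
  by rewrite (perm_mem (msuppMX _ _)) => /mapP[u up ->]; rewrite addmC; apply/JX/H.
have le_d a : a \in mingens I -> (d <= a)%MM.
  by move=> aA; apply/mnm_lepP => j; rewrite dE; case/andP: (lo_hi j a aA).
have JG m : m \in mingens J <-> (m + d)%MM \in mingens I.
  rewrite !mingensP // /minimal_in /minimal JX; split=> -[Im min_m]; split=> // m'.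
    move=> Im' le_m'; have [a aA le_a] := proj1 (mem_monomial m' mI) Im'.
    have dm' := lepm_trans (le_d a aA) le_a.
    rewrite -(submK dm') in Im' le_m' *; congr (_ + _)%MM; apply: min_m; first exact/JX.
    by apply/mnm_lepP => j; move/mnm_lepP/(_ j): le_m'; rewrite !mnmDE leq_add2r.
  move=> /JX Im' le_m'; have : (m' + d = m + d)%MM.
    by apply: min_m => //; apply/mnm_lepP => j; rewrite !mnmDE leq_add2r (mnm_lepP le_m').
  by move/(congr1 (fun u => u - d)%MM); rewrite !addmK.
rewrite /dist -/d -/J; apply/eqP; rewrite eqn_leq; apply/andP; split.
  apply/bigmax_leqP_seq => m /JG/(lo_hi i)/andP[_]; rewrite mnmDE dE => le _.
  by rewrite leq_subRL; lia.
have [a aA <-] := hi_eq i; have /JG aJ : (a - d + d)%MM \in mingens I by rewrite submK ?le_d.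
by rewrite -(dE i) -mnmBE; apply: leq_bigmax_seq aJ isT.
Qed.

Lemma pair_idealP g h : monomial_ideal (pair_ideal (k := k) g h).
Proof. exact: monomial_mon_ideal. Qed.

Lemma mingens_pair g h m : ~ (g <= h)%MM -> ~ (h <= g)%MM ->
  m \in mingens (pair_ideal (k := k) g h) <-> m = g \/ m = h.
Proof.
move=> gh hg; rewrite mingensP; last exact: pair_idealP.
have inP (u : mon) : pair_ideal (k := k) g h 'X_[u] <-> (g <= u)%MM \/ (h <= u)%MM.
  rewrite /pair_ideal mon_idealX; split=> [[v [->|->] le]|[le|le]]; [by left|by right| |].
  - by exists g => //; left.
  - by exists h => //; right.
split=> [[/inP[le|le] min_m]|].
- by left; rewrite (min_m g) //; apply/inP; left; apply: lepm_refl.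
- by right; rewrite (min_m h) //; apply/inP; right; apply: lepm_refl.
move=> [->|->]; split; try by apply/inP; (left + right); apply: lepm_refl.
  by move=> u /inP[le_u|le_u] le; [apply: mon_anti|case: hg; apply: lepm_trans le].
by move=> u /inP[le_u|le_u] le; [case: gh; apply: lepm_trans le|apply: mon_anti].
Qed.

Lemma dist2E i g h : ~ (g <= h)%MM -> ~ (h <= g)%MM ->
  dist2 k i g h = (maxn (g i) (h i) - minn (g i) (h i))%N.
Proof.
move=> gh hg; have gensP m := mingens_pair m gh hg.
apply: (distE (lo := fun i => minn (g i) (h i)) (hi := fun i => maxn (g i) (h i))).
- exact: pair_idealP.
- by move=> j a /gensP[]->; lia.
- by move=> j; have [le|lt] := leqP (g j) (h j); [exists g|exists h] => //;
    apply/gensP; [left|right].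
- by move=> j; have [le|lt] := leqP (g j) (h j); [exists h|exists g] => //;
    apply/gensP; [right|left].
Qed.

Lemma sumset_pair g h n z : sumset [fset g; h]%fset n z ->
  exists a b, (a + b = n)%N /\ z = msum (nseq a g ++ nseq b h).
Proof.
move=> [s [sA <- ->]] {n z}; elim: s sA => [|u s IHs] sA.
  by exists 0%N, 0%N.
have [|a [b [Eab Es]]] := IHs.
  by move=> v vs; apply: sA; rewrite inE vs orbT.
have : u \in [fset g; h]%fset by apply: sA; apply: mem_head.
rewrite !inE /= -Eab msum_cons Es => /orP[]/eqP->.
  by exists a.+1, b; rewrite -msum_cons.
exists a, b.+1; split; first by rewrite addnS.
by rewrite -msum_cons; apply/perm_msum; rewrite /= perm_sym perm_catC /= perm_cons perm_catC.
Qed.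

Lemma persistent_vertex I f : monomial_ideal I -> vertex (mingens I) f -> persistent I f.
Proof.
move=> mI [fA vert]; split=> // g h /(mem_monomial _ mI) gI neq_g
  /(mem_monomial _ mI) hI neq_h /mon_idealX[f' [n n0]].
have same : same_ideal (pair_ideal (k := k) g h)
    (mon_ideal (fun m => m \in [fset g; h]%fset)).
  apply: same_monomial; [exact: pair_idealP|exact: monomial_mon_ideal|].
  move=> m; rewrite /pair_ideal !mon_idealX; split=> -[u uP le]; exists u => //.
    by rewrite !inE; case: uP => ->; rewrite eqxx ?orbT.
  by move: uP; rewrite !inE => /orP[]/eqP->; [left|right].
rewrite mpolyXn (pow_mon_ideal n same _) mon_idealX => -[z /sumset_pair[a [b [Eab ->]]] le_z] le_f.
have ab0 : (0 < a + b)%N by rewrite Eab.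
apply: (vert _ _ gI neq_g hI neq_h _ _ ab0); apply: lepm_trans le_z _.
by rewrite Eab; apply/mnm_lepP => i; rewrite !mulmnE leq_mul2r (mnm_lepP le_f) orbT.
Qed.

Lemma weakly_persistent_stable I f : monomial_ideal I -> weakly_persistent I f ->
  f \in mingens I /\ stable (mingens I) f.
Proof.
move=> mI [fA wp]; split=> // n n0; apply/(mingens_pow _ _ mI).
exact: wp.
Qed.

End MonIdeal.

(** * The chain of P and its parameters *)

Lemma mem_consec (P : {fset mon}) u : u \in consec P <->
  exists2 i, (i < (size (chain_points P)).-1)%N
    & u = (nth 0%MM (chain_points P) i, nth 0%MM (chain_points P) i.+1).
Proof.
rewrite /consec -/(chain_points P); set s := chain_points P.
have sz : size (zip s (behead s)) = (size s).-1.
  by rewrite size_zip size_behead; apply/minn_idPr; apply: leq_pred.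
split=> [uz|[i ik ->]].
  exists (index u (zip s (behead s))); first by rewrite -sz index_mem.
  rewrite -{1}(nth_index (0%MM, 0%MM) uz) nth_zip_cond index_mem uz.
  by rewrite nth_behead.
rewrite -nth_behead -[X in X \in _](_ : nth (0%MM, 0%MM) (zip s (behead s)) i = _).
  by rewrite mem_nth ?sz.
by rewrite nth_zip_cond sz ik.
Qed.

(** The chain read backwards is a chain for the exchanged coordinates; this is
    how the argument is run along y. *)
Lemma boundary_chain_rev (X Y : 'I_2) A g n : boundary_chain X Y A g n ->
  boundary_chain Y X A (fun i => g (n - i)%N) n.
Proof.
move=> C; have XY := chain_coord C.
have rev i : (i < n)%N -> (n - i = (n - i.+1).+1)%N by lia.
split.
- by rewrite eq_sym.
- exact: chain_gt0 C.
- exact: chain_anti C.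
- by move=> i _; apply: (chain_sub C); apply: leq_subr.
- by move=> i lt_i; rewrite [in leqLHS](rev i lt_i); apply: (chain_stepY C); lia.
- by move=> i lt_i; rewrite [in leqRHS](rev i lt_i); apply: (chain_stepX C); lia.
- move=> a /(chain_between C)[i [lt_i _ /andP[lo hi]]]; rewrite subn0 subnn.
  rewrite (leq_trans _ lo) ?(leq_trans hi) //; first exact: (chain_leY C (leq0n i) (ltnW lt_i)).
  exact: (chain_leY C lt_i (leqnn n)).
move=> i a lt_i aA; rewrite (rev i lt_i).
have lt_j : (n - i.+1 < n)%N by lia.
have := chain_edge C lt_j aA.
have := chain_stepX C lt_j; have := chain_stepY C lt_j; nia.
Qed.

Section Final.
Variables (k : fieldType) (I : {mpoly k[2]} -> Prop) (P : {fset mon}).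
Hypotheses (monI : monomial_ideal I) (nprI : ~ principal I).
Hypothesis persP : forall f, persistent I f -> f \in P.
Hypothesis wpersP : forall f, f \in P -> weakly_persistent I f.

Let A := mingens I.
Let g := nth 0%MM (chain_points P).
Let n := (size (chain_points P)).-1.

Lemma size_points : size (chain_points P) = n.+1.
Proof.
have [a [_ [aA _ _]]] := nonprincipal_two monI nprI.
have [f /(persistent_vertex monI)/persP fP _] :=
  exists_vertex 0 (isT : ix != iy) (isT : (0 < 1)%N) (ex_intro (fun b => b \in A) a aA).
have: f \in chain_points P by rewrite mem_sort.
by rewrite /n; case: chain_points.
Qed.

Lemma card_points : #|` P| = n.+1.
Proof. by rewrite -size_points size_sort. Qed.

Lemma points_reflect a : reflect (exists2 i, (i <= n)%N & a = g i) (a \in P).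
Proof.
have memE b : (b \in chain_points P) = (b \in P) by rewrite mem_sort.
apply: (iffP idP) => [aP|[i ik ->]]; last by rewrite -memE mem_nth // size_points.
exists (index a (chain_points P)); first by rewrite -ltnS -size_points index_mem memE.
by rewrite /g nth_index // memE.
Qed.

Lemma chain_of_ideal : boundary_chain ix iy A g n.
Proof.
apply: boundary_chain_vertices.
- by [].
- by move=> a b; apply: mingens_anti.
- exact: nonprincipal_two.
- by move=> i i_le; apply/(weakly_persistent_stable monI)/wpersP/points_reflect; exists i.
- by move=> f /(persistent_vertex monI)/persP/points_reflect.
move=> i lt_i; have sz := size_points; split.
  have tot : total (fun a b : mon => b iy <= a iy)%N.
    by move=> a b; apply: leq_total.
  by move/(sortedP 0%MM): (sort_sorted tot P) => /(_ i); apply; rewrite -/(chain_points P) sz.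
by rewrite nth_uniq ?sort_uniq ?fset_uniq // ?sz; lia.
Qed.
Let C := chain_of_ideal.

Lemma dist_chain : dist ix I = (g n ix - g 0%N ix)%N /\
  dist iy I = (g 0%N iy - g n iy)%N.
Proof.
have C' := boundary_chain_rev C.
have g0A := chain_sub C (leq0n n); have gnA := chain_sub C (leqnn n).
pose lo i := if i == ix then g 0%N ix else g n iy.
pose hi i := if i == ix then g n ix else g 0%N iy.
have distE' i : dist i I = (hi i - lo i)%N.
  apply: distE => // [j a aA|j|j]; case: (coord2 (chain_coord C) j) => ->.
  - exact: chain_ext C _ aA.
  - by have := chain_ext C' aA; rewrite subn0 subnn.
  - by exists (g 0%N).
  - by exists (g n).
  - by exists (g n).
  - by exists (g 0%N).
by rewrite !distE'.
Qed.

Lemma dist2_step i : (i < n)%N -> dist2 k ix (g i) (g i.+1) = (g i.+1 ix - g i ix)%N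
  /\ dist2 k iy (g i) (g i.+1) = (g i iy - g i.+1 iy)%N.
Proof.
move=> lt_i; have ltX := chain_stepX C lt_i; have ltY := chain_stepY C lt_i.
have [le1 le2] : ~ (g i <= g i.+1)%MM /\ ~ (g i.+1 <= g i)%MM.
  by rewrite !(mon_leE _ _ (chain_coord C)); split; lia.
by rewrite !dist2E //; lia.
Qed.

(** The ceiling defining r_i(P,D) is nonnegative and, for every edge, r_i(P,D)
    times its extent is at least D times the extent of I. *)
Lemma rdir_bound i (D : nat) u : u \in consec P -> (0 < dist2 k i u.1 u.2)%N ->
  exists2 r : nat, rdir i I P D = r%:Z & (D * dist i I <= r * dist2 k i u.1 u.2)%N.
Proof.
move=> uP w0; set w := dist2 _ _ _ _ in w0 *.
have le_ceil : D%:Q * ((dist i I)%:Q / w%:Q) <= (rdir i I P D)%:~R.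
  apply: le_trans (ceil_ge _); rewrite ler_wpM2l ?ler0z //.
  exact: (le_bigmax_seq _ _ _ _ uP).
have w0' : 0 < w%:Q :> rat by rewrite ltr0z.
have r0 : 0 <= rdir i I P D.
  rewrite -(ler0z rat); apply: le_trans le_ceil.
  by rewrite mulr_ge0 ?divr_ge0 ?ler0z.
exists `|rdir i I P D|%N; first by rewrite gez0_abs.
move: le_ceil; rewrite mulrA ler_pdivrMr // -!intrM ler_int.
by rewrite -{1}(gez0_abs r0) -!PoszM lez_nat.
Qed.

(** The integers delta_P, d_P and D are natural numbers: edges have positive side
    lengths, and A has extent at least 2 in both directions if it contains three
    points of an antichain. *)
Lemma DP_nat (D : int) : DP I P <= D -> exists D' delta d : nat,
  [/\ D = D'%:Z,
   forall i, (i < n)%N -> (minn (g i.+1 ix - g i ix) (g i iy - g i.+1 iy) <= delta.+1)%N,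
   (1 < n)%N -> (minn (g n ix - g 0%N ix) (g 0%N iy - g n iy) <= d.+2)%N
   & ((#|` A| - #|` P|) * delta + #|` P| * d <= D')%N].
Proof.
have k0 := chain_gt0 C; have [dist_ix dist_iy] := dist_chain.
pose m := \max_(u <- consec P) minn (dist2 k ix u.1 u.2) (dist2 k iy u.1 u.2).
have le_m i : (i < n)%N -> (minn (g i.+1 ix - g i ix) (g i iy - g i.+1 iy) <= m)%N.
  move=> lt_i; have uP : (g i, g i.+1) \in consec P by apply/mem_consec; exists i.
  have [<- <-] := dist2_step lt_i.
  by rewrite /m (big_rem _ uP) /= leq_maxl.
have m0 : (0 < m)%N.
  apply: leq_trans (le_m 0%N k0); rewrite leq_min !subn_gt0.
  by rewrite (chain_stepX C) ?(chain_stepY C).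
pose d := if (1 < n)%N then (minn (dist ix I) (dist iy I) - 2)%N else 0%N.
have PA : (#|` P| <= #|` A|)%N.
  by apply/fsubset_leq_card/fsubsetP => a /wpersP[].
have Ed : dP I P = d%:Z.
  rewrite /dP card_points ltnS /d; case: ifP => // n1.
  have : (2 <= minn (dist ix I) (dist iy I))%N; last by lia.
  have x1 := chain_stepX C k0; have x2 := chain_ltX C n1 (leqnn n).
  have y1 := chain_stepY C k0; have y2 := chain_ltY C n1 (leqnn n).
  by rewrite dist_ix dist_iy leq_min; lia.
have EDP : DP I P = ((#|` A| - #|` P|) * m.-1 + #|` P| * d)%N.
  rewrite /DP Ed /delta -/m /mu -/A; have -> : m%:Z - 1 = m.-1%:Z by lia.
  by rewrite subzn // -!PoszM -PoszD.
move=> le_D; exists `|D|%N, m.-1, d; split.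
- by rewrite gez0_abs //; apply: le_trans le_D; rewrite EDP.
- by move=> i /le_m; rewrite prednK.
- by rewrite /d => n1; rewrite n1 dist_ix dist_iy; lia.
by rewrite EDP in le_D; lia.
Qed.

Lemma second_difference_mu (D : int) (s : nat) :
  DP I P <= D -> D + rP I P D + 1 <= s%:Z ->
  (mu (ideal_pow I s.+2) + mu (ideal_pow I s) = 2 * mu (ideal_pow I s.+1))%N.
Proof.
move=> /DP_nat[D' [delta [d [-> le_delta le_d le_D]]]] le_s.
have factor m u : minsum A m u -> _ :=
  factor_along_edge C points_reflect le_delta le_d le_D.
have GE m u : u \in mingens (ideal_pow I m) <-> minsum A m u by apply: mingens_pow.
have k0 := chain_gt0 C; have [dist_ix dist_iy] := dist_chain.
have inP i : (i < n)%N -> (g i, g i.+1) \in consec P by move=> ?; apply/mem_consec; exists i.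
have r_of Z : (forall i, (i < n)%N -> (0 < dist2 k Z (g i) (g i.+1))%N) ->
    rP I P D' = rdir Z I P D' -> exists2 r : nat, (D' + r + 1 <= s)%N &
    forall i, (i < n)%N -> (D' * dist Z I <= r * dist2 k Z (g i) (g i.+1))%N.
  move=> pos Er; have [r Err _] := rdir_bound D' (inP _ k0) (pos _ k0).
  exists r; first by move: le_s; rewrite Er Err; lia.
  move=> i lt_i; have [r' + le_r'] := rdir_bound D' (inP _ lt_i) (pos _ lt_i).
  by rewrite Err => -[->].
have [Er|Er] : rP I P D' = rdir ix I P D' \/ rP I P D' = rdir iy I P D'.
  by rewrite /rP minEle; case: ifP; [left|right].
- have [|r le_r rP] := r_of ix _ Er.
    by move=> i lt_i; have [-> _] := dist2_step lt_i; rewrite subn_gt0 (chain_stepX C).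
  apply: (second_difference C GE factor le_r) => i lt_i.
  by have := rP i lt_i; have [-> _] := dist2_step lt_i; rewrite dist_ix.
have [|r le_r rP] := r_of iy _ Er.
  by move=> i lt_i; have [_ ->] := dist2_step lt_i; rewrite subn_gt0 (chain_stepY C).
have factor' m u : minsum A m u -> exists s j, [/\ {subset s <= A}, size s = m, u = msum s, (j < n)%N
    & (count (fun a => (a != g (n - j)%N) && (a != g (n - j.+1)%N)) s <= D')%N].
  move=> /factor[t [j [tA sz_t Eu lt_j few]]]; exists t, (n - j.+1)%N; split=> //.
    by lia.
  have -> : (n - (n - j.+1) = j.+1)%N by lia.
  have -> : (n - (n - j.+1).+1 = j)%N by lia.
  by rewrite (eq_count (a2 := fun a => (a != g j) && (a != g j.+1))) // => a; apply: andbC.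
apply: (second_difference (boundary_chain_rev C) GE factor' le_r) => i lt_i.
have lt_j : (n - i.+1 < n)%N by lia.
have := rP _ lt_j; have [_ ->] := dist2_step lt_j; rewrite dist_iy subn0 subnn.
by have -> : ((n - i.+1).+1 = n - i)%N by lia.
Qed.

End Final.

Theorem corollary5p11 (k : fieldType) (I : {mpoly k[2]} -> Prop)
  (P : {fset 'X_{1..2}}) (D : int) (s : nat)
  (monI : monomial_ideal I) (nprI : ~ principal I)
  (persP : forall f : 'X_{1..2}, persistent I f -> f \in P)
  (wpersP : forall f : 'X_{1..2}, f \in P -> weakly_persistent I f)
  (hD : DP I P <= D)
  (hs : D + rP I P D + 1 <= s%:Z) (l : nat) :
  (mu (ideal_pow I (s + l)))%:Z =
    (mu (ideal_pow I s))%:Z +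
    l%:Z * ((mu (ideal_pow I s.+1))%:Z - (mu (ideal_pow I s))%:Z).
Proof.
have diff t : (s <= t)%N ->
    (mu (ideal_pow I t.+2) + mu (ideal_pow I t) = 2 * mu (ideal_pow I t.+1))%N.
  move=> st; apply: (second_difference_mu monI nprI persP wpersP hD).
  by apply: le_trans hs _; rewrite lez_nat.
pose f t := (mu (ideal_pow I t))%:Z.
suff [] : f (s + l)%N = f s + l%:Z * (f s.+1 - f s) /\
       f (s + l).+1 = f (s + l)%N + (f s.+1 - f s) by [].
elim: l => [|l [IH1 IH2]]; first by rewrite addn0 mul0r addr0 addrC subrK.
rewrite addnS; split; first by rewrite IH2 IH1; lia.
by have := diff _ (leq_addr l s); rewrite /f in IH1 IH2 *; lia.
Qed.
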